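(* Let $\{(Y_t,X_t)\}_{t=1}^{\infty}$ be an ergodic hidden Markov model satisfying A1 and A2, let $l:S\times S\to[0,\infty)$ be a loss function, and let $\tilde V^n=v^n(X^n)$, where the finite Viterbi alignments $v^n$ are chosen consistently. Put $$R_1(Y^n,X^n)=\frac1n\sum_{t=1}^n l(Y_t,\tilde V^n_t),\qquad R_1(v,X^n)=E[R_1(Y^n,X^n)\mid X^n]=\frac1n\sum_{t=1}^n\sum_{a\in S}l(a,\tilde V_t^n)\,\mathbf P(Y_t=a\mid X^n).$$ Then there exists a constant $R_1\ge 0$ such that $$\lim_{n\to\infty}R_1(Y^n,X^n)=\lim_{n\to\infty}R_1(v,X^n)=R_1\quad\text{almost surely and in }L_1 .$$ Moreover, $E R_1(v,X^n)\to R_1$.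
   Context: Hidden Markov model (HMM): $Y=\{Y_t\}$ is a stationary Markov chain with finite state space $S=\{1,\dots,|S|\}$ and irreducible aperiodic transition matrix $(P(i,j))$, also written $p_{ij}=P(i,j)$. $X=\{X_t\}$ takes values in a measurable space $(\mathcal X,\mathcal B)$ (usually $\mathbb R^d$ with the Borel sets); given $Y$, the $X_t$ are conditionally independent, and the law of $X_t$ depends on $Y$ only through $Y_t$. The emission distributions $P_s=\mathbf P(X_1\in\cdot\mid Y_1=s)$ have densities $f_s$ with respect to a reference measure $\mu$. Such a model is called ergodic. Write $X^n=(X_1,\dots,X_n)$, $Y^n=(Y_1,\dots,Y_n)$. Let $G_s=\{x\in\mathcal X:f_s(x)>0\}$. A set $C\subset S$ is a cluster if $\min_{j\in C}P_j(\cap_{s\in C}G_s)>0$ and $\max_{j\notin C}P_j(\cap_{s\in C}G_s)=0$. A1: there is a cluster $C\subset S$ such that the matrix $R=(P(i,j))_{i,j\in C}$ is primitive, i.e. $R^r$ is strictly positive for some positive integer $r$. A2: for each $l\in S$, $P_l(\{x\in\mathcal X: f_l(x)p_l^*>\max_{s\ne l}f_s(x)p_s^*\})>0$, where $p_l^*=\max_j p_{jl}$. For the cluster $C$ in A1 there exist a set $\mathcal X_o\subset\cap_{s\in C}G_s$ and $\epsilon>0$, $M<\infty$ with $\mu(\mathcal X_o)>0$ and, for all $x\in\mathcal X_o$: $\epsilon<\min_{s\in C}f_s(x)$, $\max_{s\in C}f_s(x)<M$, $\max_{s\notin C}f_s(x)=0$. Such a set is fixed, and $W_t=\min\{\tau\ge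 t+r+1: X_{\tau-r}^{\tau}\in\mathcal X_o^{r+1}\}$, $U_t=\max\{\tau\le t-r-1: X_\tau^{\tau+r}\in\mathcal X_o^{r+1}\}$, where $X_a^b=(X_a,\dots,X_b)$. A finite Viterbi alignment is a map $v^n:\mathcal X^n\to S^n$ with $v^n(x^n)\in\arg\max_{s^n\in S^n}\mathbf P(Y^n=s^n\mid X^n=x^n)$. The alignments extend to an infinite Viterbi alignment $v:\mathcal X^\infty\to S^\infty$ if for almost every realization $x^\infty$ and every $k$ there is $m\geq k$ such that for all $n\ge m$ the first $k$ elements of $v^n(x^n)$ and $v(x^\infty)$ coincide. Put $V=\{V_t\}_{t\ge1}=v(X)$. Consistent choice: it is known that under A1, A2 the finite Viterbi alignments (ties broken suitably) can be chosen so that an infinite Viterbi alignment exists and the following holds; such a choice is called consistent. (R1) $Z=(X,Y,V)$ is a positive recurrent aperiodic classical regenerative process with respect to some renewal process $\{S_t\}_{t\ge0}$ (i.e. for each $k$ the shifted process $\theta_{S_k}(Z,S)$ is independent of the past up to $S_k$ and its law does not depend on $k$; $T_1=S_1-S_0$ satisfies $ET_1<\infty$ and $\mathbf P(T_1\in a\mathbb N)<1$ for all $a>1$). (R2) There is an integer $m>0$ with $S_0>m$, such that for all $j\ge0$ with $S_j+m\le n$, $\tilde V_t^n=V_t$ for all $t\le S_j$, and $S_j-S_{j-1}\ge m$ for $j\ge1$. (R3) If $S_k>t$ then $W_t\le S_k+m$; if $S_k<t$ then $U_t>S_k-m$. *)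

(* Defs.v *)
From HB Require Import structures.
From mathcomp Require Export all_boot all_order all_algebra.
From mathcomp Require Export all_classical all_reals all_analysis.

Set Implicit Arguments.
Unset Strict Implicit.
Unset Printing Implicit Defensive.

Import Order.TTheory GRing.Theory Num.Theory.
Import numFieldNormedType.Exports.

Local Open Scope classical_set_scope.
Local Open Scope ring_scope.

(* A state space of N.+1 elements, nonempty because measurable types are
   pointed, with the discrete sigma-algebra. *)
HB.instance Definition _ (N : nat) := isPointed.Build 'I_N.+1 ord0.
HB.instance Definition _ (N : nat) := @isMeasurable.Build
  default_measure_display 'I_N.+1 discrete_measurable discrete_measurable0
  discrete_measurableC discrete_measurableU.

(* Time convention: [X i] and [Y i] stand for X_{i+1} and Y_{i+1}, so that
   [first_n X n] is X^n = (X_1, ..., X_n). *)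
Definition first_n {Om E : Type} (X : nat -> Om -> E) (n : nat) (w : Om) :
  n.-tuple E := [tuple X i w | i < n].

Definition sigma_of {Om : Type} {d} {E : measurableType d}
    (Z : nat -> Om -> E) : set (set Om) :=
  <<s [set A | exists t, exists2 B, measurable B & A = Z t @^-1` B] >>.

Definition sigma_first_n {Om : Type} {d} {E : measurableType d}
    (X : nat -> Om -> E) (n : nat) : set (set Om) :=
  preimage_set_system setT (first_n X n) measurable.

(* [g] is a version of E[Z | F]. *)
Definition is_cond_exp {d} {Om : measurableType d} {R : realType}
    (P : probability Om R) (F : set (set Om)) (Z g : Om -> R) : Prop :=
  [/\ forall B, measurable B -> F (g @^-1` B),
      P.-integrable setT (EFin \o g)
    & forall A, F A ->
        (\int[P]_(w in A) (g w)%:E = \int[P]_(w in A) (Z w)%:E)%E].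

Record ergodic_stochastic {R : realType} {N : nat} (p : 'M[R]_N.+1) : Prop := {
  stoch_ge0 : forall i j, 0 <= p i j ;
  stoch_sum1 : forall i, \sum_j p i j = 1 ;
  stoch_irreducible : forall i j, exists n, 0 < (p ^+ n) i j ;
  stoch_aperiodic : forall i (k : nat),
    (forall n, (0 < n)%N -> 0 < (p ^+ n) i i -> (k %| n)%N) -> k = 1%N }.

Record ergodic_hmm {d d'} {Om : measurableType d} {T : measurableType d'}
    {R : realType} (P : probability Om R) {N : nat}
    (Y : nat -> {RV P >-> 'I_N.+1}) (X : nat -> {RV P >-> T}) (p : 'M[R]_N.+1)
    (mu : {measure set T -> \bar R}) (f : 'I_N.+1 -> T -> R)
    (Pe : 'I_N.+1 -> probability T R) : Prop := {
  hmm_transition : ergodic_stochastic p ;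
  hmm_markov : forall n (s : nat -> 'I_N.+1),
    (P [set w | forall i, (i <= n.+1)%N -> Y i w = s i] =
     P [set w | forall i, (i <= n)%N -> Y i w = s i] *
       (p (s n) (s n.+1))%:E)%E ;
  hmm_stationary : forall k n (s : nat -> 'I_N.+1),
    P [set w | forall i, (i < n)%N -> Y (k + i)%N w = s i] =
    P [set w | forall i, (i < n)%N -> Y i w = s i] ;
  hmm_emission : forall n (B : nat -> set T), (forall i, measurable (B i)) ->
    is_cond_exp P (sigma_of Y)
      (\1_[set w | forall i, (i < n)%N -> B i (X i w)])
      (fun w => \prod_(i < n) fine (Pe (Y i w) (B i))) ;
  hmm_density_measurable : forall s, measurable_fun setT (f s) ;
  hmm_density_ge0 : forall s x, 0 <= f s x ;
  hmm_density : forall s B, measurable B ->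
    (Pe s B = \int[mu]_(x in B) (f s x)%:E)%E }.

Section assumptions.
Context {d'} {T : measurableType d'} {R : realType} {N : nat}.
Implicit Types (C : {set 'I_N.+1}) (p : 'M[R]_N.+1) (f : 'I_N.+1 -> T -> R)
  (Pe : 'I_N.+1 -> probability T R).

Definition support_cap f C : set T := [set x | forall s, s \in C -> 0 < f s x].

Definition is_cluster f Pe C : Prop :=
  [/\ (0 < #|C|)%N,
      forall j, j \in C -> (0 < Pe j (support_cap f C))%E
    & forall j, j \notin C -> Pe j (support_cap f C) = 0%E].

Definition submatrix p C : 'M[R]_#|C| :=
  \matrix_(i, j) p (enum_val i) (enum_val j).

Definition primitive_with_exponent p C (r : nat) : Prop :=
  (0 < r)%N /\ forall i j, 0 < (submatrix p C ^+ r) i j.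

Definition pstar p (l : 'I_N.+1) : R := \big[Num.max/0]_(j < N.+1) p j l.

Definition assumption_A2 p f Pe : Prop := forall l,
  (0 < Pe l [set x | forall s, s != l ->
                       (f s x * pstar p s < f l x * pstar p l)%R])%E.

Definition good_emission_set (mu : {measure set T -> \bar R}) f C
    (Xo : set T) : Prop :=
  [/\ measurable Xo, Xo `<=` support_cap f C, (0 < mu Xo)%E
    & exists eps M : R, 0 < eps /\ forall x, Xo x ->
        (forall s, s \in C -> eps < f s x < M) /\
        (forall s, s \notin C -> f s x = 0)].

End assumptions.

(* The shifted process theta_{S_k}(Z, S), encoded as one sequence of pairs
   (Z_{S_k + t + 1}, S_{k+t} - S_k), t >= 0; recall that [Z i] is Z_{i+1}. *)
Definition shifted {Om E : Type} (Z : nat -> Om -> E) (S : nat -> Om -> nat)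
    (k : nat) (w : Om) : nat -> E * nat :=
  fun t => (Z (S k w + t)%N w, (S (k + t) w - S k w)%N).

(* The sigma-algebra of (Z_1, ..., Z_{S_k}, S_0, ..., S_k). *)
Definition past_sigma {Om : Type} {d} {E : measurableType d}
    (Z : nat -> Om -> E) (S : nat -> Om -> nat) (k : nat) : set (set Om) :=
  <<s [set A | (exists j i, (j <= k)%N /\ A = [set w | S j w = i]) \/
               (exists t, exists2 B, measurable B &
                  A = [set w | (t < S k w)%N /\ B (Z t w)])] >>.

Section regenerative.
Context {d dE} {Om : measurableType d} {E : measurableType dE} {R : realType}.
Variable P : probability Om R.
Implicit Types (Z : nat -> Om -> E) (S : nat -> {RV P >-> nat}).

(* That the T_k = S_k - S_{k-1}, k >= 1, are i.i.d. and independent of S_0 is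
   contained in [reg_indep] and [reg_law], since the shifted process contains
   the shifted renewal times. *)
Record classical_regenerative Z S : Prop := {
  reg_measurable : forall t, measurable_fun setT (Z t) ;
  reg_increasing : {ae P, forall w, forall k, (S k w < S k.+1 w)%N} ;
  reg_indep : forall k A (D : set (nat -> E * nat)),
    past_sigma Z S k A -> sigma_of (fun t z => z t) D ->
    (P (A `&` shifted Z S k @^-1` D) = P A * P (shifted Z S k @^-1` D))%E ;
  reg_law : forall k (D : set (nat -> E * nat)),
    sigma_of (fun t z => z t) D ->
    P (shifted Z S k @^-1` D) = P (shifted Z S 0 @^-1` D) }.

Definition positive_recurrent S : Prop :=
  ('E_P[fun w => (S 1%N w - S 0%N w)%N%:R] < +oo)%E.

Definition aperiodic_renewal S : Prop := forall a : nat, (1 < a)%N ->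
  (P [set w | (a %| S 1 w - S 0 w)%N] < 1)%E.

End regenerative.

(* The sets of which W_t is the minimum and U_t the maximum, in 1-based
   time: the observation at time u >= 1 is [x u.-1]. *)
Definition W_set {T : Type} (Xo : set T) (r : nat) (x : nat -> T) (t : nat) :
  set nat := [set tau | (t + r + 1 <= tau)%N /\
    forall u, (tau - r <= u <= tau)%N -> Xo (x u.-1)].

Definition U_set {T : Type} (Xo : set T) (r : nat) (x : nat -> T) (t : nat) :
  set nat := [set tau | (1 <= tau)%N /\ (tau + r + 1 <= t)%N /\
    forall u, (tau <= u <= tau + r)%N -> Xo (x u.-1)].

Definition is_min (A : set nat) (a : nat) : Prop :=
  A a /\ forall b, A b -> (a <= b)%N.

Definition is_max (A : set nat) (a : nat) : Prop :=
  A a /\ forall b, A b -> (b <= a)%N.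

Section viterbi.
Context {d d'} {Om : measurableType d} {T : measurableType d'} {R : realType}.
Variables (P : probability Om R) (N : nat).
Variables (Y : nat -> {RV P >-> 'I_N.+1}) (X : nat -> {RV P >-> T}).

(* [q s x] is a version of P(Y^n = s | X^n = x). *)
Definition is_posterior (n : nat) (q : n.-tuple 'I_N.+1 -> n.-tuple T -> R) :
    Prop := forall s,
  measurable_fun setT (q s) /\
  is_cond_exp P (sigma_first_n X n) (\1_(first_n Y n @^-1` [set s]))
    (q s \o first_n X n).

Definition is_viterbi (n : nat) (q : n.-tuple 'I_N.+1 -> n.-tuple T -> R)
    (v : n.-tuple T -> n.-tuple 'I_N.+1) : Prop :=
  forall x s, q s x <= q (v x) x.

Variable v : forall n, {mfun (n.-tuple T) >-> (n.-tuple 'I_N.+1)}.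

Definition is_infinite_alignment
    (vinf : (nat -> T) -> (nat -> 'I_N.+1)) : Prop :=
  {ae P, forall w, forall k, exists2 m, (k <= m)%N &
    forall n, (m <= n)%N -> forall i : 'I_n, (i < k)%N ->
      tnth (v n (first_n X n w)) i = vinf (X ^~ w) i}.

(* A consistent choice, relative to the set [Xo] fixed for the cluster and
   blocks of length r + 1. *)
Definition consistent (Xo : set T) (r : nat) : Prop :=
  exists vinf : (nat -> T) -> (nat -> 'I_N.+1),
  let V t w := vinf (X ^~ w) t in
  is_infinite_alignment vinf /\
  exists (S : nat -> {RV P >-> nat}) (m : nat),
  [/\ [/\ classical_regenerative (fun t w => (X t w, Y t w, V t w)) S,
          positive_recurrent S & aperiodic_renewal S],
      (0 < m)%N,
      {ae P, forall w,
        [/\ (m < S 0 w)%N,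
            forall j n, (S j w + m <= n)%N ->
              forall i : 'I_n, (i < S j w)%N ->
                tnth (v n (first_n X n w)) i = V i w
          & forall j, (S j w + m <= S j.+1 w)%N]}
    & {ae P, forall w, forall k t, (1 <= t)%N ->
        ((t < S k w)%N -> exists2 W, is_min (W_set Xo r (X ^~ w) t) W &
                            (W <= S k w + m)%N) /\
        ((S k w < t)%N -> exists2 U, is_max (U_set Xo r (X ^~ w) t) U &
                            (S k w < U + m)%N)}].

(* R_1(Y^n, X^n) *)
Definition empirical_risk (l : 'I_N.+1 -> 'I_N.+1 -> R) (n : nat) (w : Om) :
    R :=
  n%:R^-1 * \sum_(i < n) l (Y i w) (tnth (v n (first_n X n w)) i).

End viterbi.

(* [A n], n >= 1, converges to the constant [c] almost surely and in L_1. *)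
Definition cvg_as_L1 {d} {Om : measurableType d} {R : realType}
    (P : probability Om R) (A : nat -> Om -> R) (c : R) : Prop :=
  {ae P, forall w, A n w @[n --> \oo] --> c} /\
  ('E_P[fun w => `|A n w - c|%R] @[n --> \oo] --> 0)%E.

(* Main.v *)
(* Up to the last renewal time S_j with S_j + m <= n the finite alignment agrees
   with V, so the empirical risk is a combination of the frequencies with which
   the regenerative process visits the states (Y, V) = (a, b).  These converge
   by a strong law for the cycles, which follows from a maximal argument: if xi
   is the contribution of the first cycle and M_n the running maximum of the
   partial sums of the cycle contributions, then M_(n+1) = max(0, xi + M_n')
   where M_n' is a copy of M_n that depends on the later cycles only; hence
   0 <= E(M_(n+1) - M_n'; A) tends to P(A) E(xi) on the event A that the partial
   sums are unbounded above, and P(A) = 0 as soon as E(xi) < 0.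

   The conditional risks E[A_n | F_n], F_n = sigma(X^n), of the bounded almost
   surely convergent sequence A_n have the same limit by Hunt's lemma, which
   comes from Doob's first-passage decomposition. *)

Require Import Defs.
From HB Require Import structures.
From mathcomp Require Import all_boot all_order all_algebra.
From mathcomp Require Import all_classical all_reals all_analysis.
From mathcomp Require Import measurable_realfun ring lra zify.

Set Implicit Arguments.
Unset Strict Implicit.
Unset Printing Implicit Defensive.

Import Order.TTheory GRing.Theory Num.Theory.
Import numFieldNormedType.Exports.

Local Open Scope classical_set_scope.
Local Open Scope ring_scope.

(** * Conditional expectations *)

Lemma negligible_bigcup_countType {d} {Om : measurableType d} {R : realType}
    (mu : {measure set Om -> \bar R}) {I : countType} (D : set I)
    (A : I -> set Om) :
  (forall i, D i -> mu.-negligible (A i)) ->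
  mu.-negligible (\bigcup_(i in D) A i).
Proof.
move=> A0.
pose B n := if unpickle n is Some i then
              if i \in D then A i else set0 else set0.
apply: (@negligibleS _ _ _ mu (\bigcup_n B n)).
  by move=> w [i Di Aw]; exists (pickle i); rewrite // /B pickleK mem_set.
apply: negligible_bigcup => n; rewrite /B.
case: unpickle => [i|]; last exact: negligible_set0.
by case: ifPn => [/set_mem/A0//|_]; exact: negligible_set0.
Qed.

Section conditional_expectation.
Context {d} {Om : measurableType d} {R : realType} (P : probability Om R).
Variable F : set (set Om).
Hypotheses (F_sigma : sigma_algebra setT F) (F_measurable : F `<=` measurable).

(** Passes from the preimage form of measurability in [is_cond_exp] to measurability on the type
    generated by [F], where closure under sums and products is available. *)
Lemma measurable_sub_sigmaP {d'} {T : measurableType d'} (g : Om -> T) :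
  (forall B, measurable B -> F (g @^-1` B)) <->
  measurable_fun setT (g : g_sigma_algebraType F -> T).
Proof.
split=> [Fg _ B mB|mg B mB].
  by rewrite setTI; apply: sub_sigma_algebra; exact: Fg.
by have := mg measurableT B mB; rewrite setTI /measurable/= sigma_algebra_id.
Qed.

Lemma sub_sigmaI A B : F A -> F B -> F (A `&` B).
Proof.
move=> FA FB; rewrite -(sigma_algebra_id F_sigma).
have := @measurableI _ (g_sigma_algebraType F) A B.
by apply; exact: sub_sigma_algebra.
Qed.

(** Where [h w < g w], two rationals q1 < q2 fit strictly in between, so the exceptional set is
    covered by the countably many events {h <= q1, q2 <= g} of [F]. Integrating both functions over
    such an event gives q2 P <= q1 P, so each is null. *)
Lemma ae_le_of_le_integral (g h : Om -> R) :
    (forall B, measurable B -> F (g @^-1` B)) ->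
    (forall B, measurable B -> F (h @^-1` B)) ->
    P.-integrable setT (EFin \o g) -> P.-integrable setT (EFin \o h) ->
    (forall A, F A ->
      (\int[P]_(w in A) (g w)%:E <= \int[P]_(w in A) (h w)%:E)%E) ->
  {ae P, forall w, g w <= h w}.
Proof.
move=> Fg Fh ig ih gh.
pose A (q : rat * rat) : set Om :=
  h @^-1` `]-oo, ratr q.1] `&` g @^-1` `[ratr q.2, +oo[.
have FA q : F (A q) by apply: sub_sigmaI; [exact: Fh|exact: Fg].
have A0 q : q.1 < q.2 -> P (A q) = 0%E.
  move=> q12.
  have mA := F_measurable (FA q).
  have le1 : ((ratr q.2)%:E * P (A q) <= \int[P]_(w in A q) (g w)%:E)%E.
    rewrite -integral_cst//; apply: le_integral => //.
    - exact: finite_measure_integrable_cst.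
    - exact: integrableS ig.
    - by move=> w /set_mem[_]; rewrite /= in_itv/= andbT lee_fin.
  have le2 : (\int[P]_(w in A q) (h w)%:E <= (ratr q.1)%:E * P (A q))%E.
    rewrite -integral_cst//; apply: le_integral => //.
    - exact: integrableS ih.
    - exact: finite_measure_integrable_cst.
    - by move=> w /set_mem[]; rewrite /= in_itv/= lee_fin.
  have := le_trans le1 (le_trans (gh _ (FA q)) le2).
  rewrite -(fineK (fin_num_measure P _ mA)) -!EFinM lee_fin => {}le.
  have q12R : ratr q.1 < ratr q.2 :> R by rewrite ltr_rat.
  have : 0 <= fine (P (A q)) by rewrite fine_ge0.
  rewrite le0r => /orP[/eqP->//|p0].
  by move: le; rewrite ler_pM2r// leNgt q12R.
have : P.-negligible (\bigcup_(q in [set q : rat * rat | q.1 < q.2]) A q).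
  apply: negligible_bigcup_countType => q /A0 PA.
  by apply/negligibleP => //; exact/F_measurable/FA.
apply: negligibleS => w /= /negP; rewrite -ltNge => hg.
have [q1 /andP[hq1 q1g]] := rat_in_itvoo hg.
have [q2 /andP[q12 q2g]] := rat_in_itvoo q1g.
exists (q1, q2) => /=; first by rewrite -(ltr_rat R).
by split; rewrite /= in_itv/= ?andbT ltW.
Qed.

Lemma cond_exp_ae_unique (Z g h : Om -> R) :
  is_cond_exp P F Z g -> is_cond_exp P F Z h -> {ae P, forall w, g w = h w}.
Proof.
move=> [Fg ig gZ] [Fh ih hZ].
have gh : {ae P, forall w, g w <= h w}.
  by apply: ae_le_of_le_integral => // A FA; rewrite gZ// hZ.
have hg : {ae P, forall w, h w <= g w}.
  by apply: ae_le_of_le_integral => // A FA; rewrite gZ// hZ.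
by apply: filterS2 gh hg => w gh hg; apply/le_anti/andP.
Qed.

Lemma cond_expZ (c : R) (Z g : Om -> R) : P.-integrable setT (EFin \o Z) ->
  is_cond_exp P F Z g ->
  is_cond_exp P F (fun w => c * Z w) (fun w => c * g w).
Proof.
move=> iZ [Fg ig gZ]; split.
- by apply/measurable_sub_sigmaP/measurable_funM => //; exact/measurable_sub_sigmaP.
- exact: (integrableZl measurableT c ig).
- move=> A FA; have mA := F_measurable FA.
  under eq_integral do rewrite EFinM.
  rewrite integralZl//; last exact: integrableS ig.
  under [RHS]eq_integral do rewrite EFinM.
  by rewrite integralZl ?gZ//; exact: integrableS iZ.
Qed.

Lemma cond_exp_sum {I : Type} (s : seq I) (Z g : I -> Om -> R) :
  (forall i, P.-integrable setT (EFin \o Z i)) ->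
  (forall i, is_cond_exp P F (Z i) (g i)) ->
  is_cond_exp P F (fun w => \sum_(i <- s) Z i w)
                  (fun w => \sum_(i <- s) g i w).
Proof.
move=> iZ ceg; split.
- apply/measurable_sub_sigmaP/measurable_sum => i.
  by apply/measurable_sub_sigmaP; case: (ceg i).
- rewrite (_ : _ \o _ = (fun w => \sum_(i <- s) (g i w)%:E)%E); last first.
    by apply/funext => w /=; rewrite -sumEFin.
  by apply: integrable_sum => // i _; case: (ceg i).
- move=> A FA; have mA := F_measurable FA.
  under eq_integral do rewrite -sumEFin.
  under [RHS]eq_integral do rewrite -sumEFin.
  rewrite !integral_sum//.
  + by apply: eq_bigr => i _; case: (ceg i) => _ _; exact.
  + by move=> i; exact: integrableS (iZ i).
  + by move=> i; case: (ceg i) => _ ig _; exact: integrableS ig.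
Qed.

Lemma integral_indicM (A B : set Om) (h : Om -> R) :
  (\int[P]_(w in A) (\1_B w * h w)%:E = \int[P]_(w in A `&` B) (h w)%:E)%E.
Proof.
rewrite integral_mkcondr; apply: eq_integral => w _; rewrite indicE patchE.
by case: (w \in B); rewrite ?mul1r ?mul0r.
Qed.

Lemma cond_exp_indicM (B : set Om) (Z g : Om -> R) : F B ->
  is_cond_exp P F Z g ->
  is_cond_exp P F (fun w => \1_B w * Z w) (fun w => \1_B w * g w).
Proof.
move=> FB [Fg ig gZ].
have mB := F_measurable FB; split.
- apply/measurable_sub_sigmaP/measurable_funM; last exact/measurable_sub_sigmaP.
  by apply: measurable_indic; exact: sub_sigma_algebra.
- have -> : EFin \o (fun w => \1_B w * g w) = (EFin \o g) \_ B.
    apply/funext => w; rewrite /= indicE patchE.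
    by case: (w \in B); rewrite ?mul1r ?mul0r.
  by rewrite -integrable_mkcond//; exact: integrableS ig.
- by move=> A FA; rewrite !integral_indicM gZ//; exact: sub_sigmaI.
Qed.

(** Taking out what is known: since [U] has finitely many values, [c (U w)] is a finite combination
    of indicators of events of [F], and linearity reduces the claim to [cond_exp_indicM]. *)
Lemma cond_exp_finM {I : finType} (U : Om -> I) (c : I -> R) (Z g : Om -> R) :
  (forall b, F (U @^-1` [set b])) -> P.-integrable setT (EFin \o Z) ->
  is_cond_exp P F Z g ->
  is_cond_exp P F (fun w => c (U w) * Z w) (fun w => c (U w) * g w).
Proof.
move=> FU iZ ceg.
have decomp (h : Om -> R) : (fun w => c (U w) * h w) =
    (fun w => \sum_b c b * (\1_(U @^-1` [set b]) w * h w)).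
  apply/funext => w; rewrite (bigD1 (U w))//= indicE mem_set// mul1r big1 ?addr0//.
  move=> b bU; rewrite indicE memNset ?mul0r ?mulr0//= => /esym/eqP.
  by rewrite (negbTE bU).
have iB b : P.-integrable setT (EFin \o (fun w => \1_(U @^-1` [set b]) w * Z w)).
  have mB := F_measurable (FU b).
  have -> : EFin \o (fun w => \1_(U @^-1` [set b]) w * Z w) =
      (EFin \o Z) \_ (U @^-1` [set b]).
    apply/funext => w; rewrite /= indicE patchE.
    by case: (w \in _); rewrite ?mul1r ?mul0r.
  by rewrite -integrable_mkcond//; exact: integrableS iZ.
rewrite !decomp; apply: cond_exp_sum => b; first exact: (integrableZl measurableT (c b) (iB b)).
by apply: cond_expZ => //; exact: cond_exp_indicM.
Qed.

End conditional_expectation.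

(** * Hunt's lemma *)

Section hunt.
Context {d} {Om : measurableType d} {R : realType} (P : probability Om R).

Lemma bounded_prob_integrable (L : R) (h : Om -> R) : measurable_fun setT h ->
  (forall w, `|h w| <= L) -> P.-integrable setT (EFin \o h).
Proof.
move=> mh hL; apply: measurable_bounded_integrable => //.
  exact: fin_num_fun_lty (fin_num_measure P).
exists L; split; first exact: num_real.
by move=> M LM w _; exact: le_trans (hL w) (ltW LM).
Qed.

(** The event {g > c} and its complement lie in [F] and fix the sign of g - c. On each of them the
    integral of |g - c| is, up to sign, that of A - c, hence at most that of |A - c|. *)
Lemma cond_exp_L1_contraction (F : set (set Om)) (A g : Om -> R) (c : R) :
    sigma_algebra setT F -> F `<=` measurable ->
    P.-integrable setT (EFin \o A) -> is_cond_exp P F A g ->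
  ('E_P[fun w => `|g w - c|%R] <= 'E_P[fun w => `|A w - c|%R])%E.
Proof.
move=> Fs Fm iA [Fg ig gA]; rewrite unlock.
have ic D : measurable D -> P.-integrable D (EFin \o cst c).
  exact: finite_measure_integrable_cst.
have iB (h : Om -> R) : P.-integrable setT (EFin \o h) ->
    P.-integrable setT (fun w => (h w - c)%:E).
  by move=> ih; have := integrableB measurableT ih (ic _ measurableT).
have iN (h : Om -> R) : P.-integrable setT (EFin \o h) ->
    P.-integrable setT (fun w => `|h w - c|%:E).
  by move=> /iB ih; have := integrable_norm ih.
pose S := g @^-1` `]c, +oo[.
have FS : F S by exact: Fg.
have FCS : F (~` S) by case: Fs => _ FC _; rewrite -setTD; exact: FC.
have mS := Fm _ FS; have mCS := Fm _ FCS.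
have split_int (h : Om -> R) : measurable_fun setT h ->
    (\int[P]_w `|h w - c|%:E = \int[P]_(w in S) `|h w - c|%:E +
       \int[P]_(w in ~` S) `|h w - c|%:E)%E.
  move=> mh; rewrite -(setUv S) ge0_integral_setU//.
  - apply: measurable_funTS; apply/measurable_EFinP/measurableT_comp => //.
    exact: measurable_funB.
  - by apply/eqP; exact: setICr.
have shift D : F D ->
    (\int[P]_(w in D) (g w - c)%:E = \int[P]_(w in D) (A w - c)%:E)%E.
  move=> FD; have mD := Fm _ FD.
  under eq_integral do rewrite EFinB.
  rewrite integralB_EFin//; [|exact: integrableS ig|exact: ic].
  under [RHS]eq_integral do rewrite EFinB.
  rewrite integralB_EFin//; [|exact: integrableS iA|exact: ic].
  by rewrite gA.
have mI (h : Om -> R) : P.-integrable setT (EFin \o h) -> measurable_fun setT h.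
  by move=> /measurable_int/measurable_EFinP.
rewrite !split_int; [|exact: mI|exact: mI].
apply: leeD.
- rewrite [leLHS](_ : _ = \int[P]_(w in S) (g w - c)%:E)%E; last first.
    apply: eq_integral => w /set_mem; rewrite /S/= in_itv/= andbT => cg.
    by rewrite ger0_norm// subr_ge0 ltW.
  rewrite shift//; apply: le_integral => //.
  + exact: integrableS (iB _ iA).
  + exact: integrableS (iN _ iA).
  + by move=> w _; rewrite lee_fin ler_norm.
- rewrite [leLHS](_ : _ = - \int[P]_(w in ~` S) (g w - c)%:E)%E; last first.
    rewrite -integralN; last first.
      by apply: integrable_add_def => //; exact: integrableS (iB _ ig).
    apply: eq_integral => w /set_mem; rewrite /S/= in_itv/= andbT => /negP cg.
    by rewrite ler0_norm ?EFinN// subr_le0 leNgt.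
  rewrite shift// -integralN; last first.
    by apply: integrable_add_def => //; exact: integrableS (iB _ iA).
  apply: le_integral => //.
  + by apply: integrableN => //; exact: integrableS (iB _ iA).
  + exact: integrableS (iN _ iA).
  + by move=> w _; rewrite -EFinN lee_fin -normrN ler_norm.
Qed.

Variable F : nat -> set (set Om).
Hypotheses (F_sigma : forall n, sigma_algebra setT (F n))
  (F_measurable : forall n, F n `<=` measurable)
  (F_mono : forall m n, (m <= n)%N -> F m `<=` F n).

(* The event that some [g n], [n >= k], exceeds [c + 2 e] is split according to
   the first such [n]; on each piece, which lies in [F n], the integral of [g n]
   is that of [A n], as in Doob's maximal inequality. *)
Lemma cond_exp_maximal_ineq (A g : nat -> Om -> R) (L c e : R) (k : nat)
    (E : set Om) : 0 < e -> (0 < k)%N -> measurable E ->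
    (forall n, measurable_fun setT (A n)) -> (forall n w, `|A n w| <= L) ->
    (forall n, (0 < n)%N -> is_cond_exp P (F n) (A n) (g n)) ->
    (forall n w, (k <= n)%N -> ~ E w -> A n w <= c + e) ->
  (P (\bigcup_i [set w | (c + e + e < g (k + i)%N w)%R]) <=
     (e^-1 * (L + `|c| + e))%:E * P E)%E.
Proof.
move=> e0 k0 mE mA AL ceg AE.
pose G i := [set w | c + e + e < g (k + i)%N w].
have FG i : F (k + i)%N (G i).
  have [Fg _ _] := ceg (k + i)%N (ltn_addr _ k0).
  rewrite (_ : G i = g (k + i)%N @^-1` `]c + e + e, +oo[); first exact: Fg.
  by apply/seteqP; split=> w; rewrite /G/= in_itv/= andbT.
(* [H i] is the event that the first passage occurs at time k + i. It involves only times up to k +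
   i and so belongs to [F (k + i)]. *)
pose H := seqDU G.
have FH i : F (k + i)%N (H i).
  rewrite -(sigma_algebra_id (F_sigma (k + i)%N)).
  rewrite /H /seqDU.
  apply: (@measurableD _ (g_sigma_algebraType (F (k + i)%N))).
    exact: sub_sigma_algebra.
  apply: (@bigsetU_measurable _ (g_sigma_algebraType (F (k + i)%N))) => j _.
  apply: sub_sigma_algebra; apply: F_mono (FG j).
  by rewrite leq_add2l ltnW.
have mH i : measurable (H i) by exact: F_measurable (FH i).
have L0 : 0 <= L by exact: le_trans (normr_ge0 _) (AL 0%N point).
have iA n D : measurable D -> P.-integrable D (EFin \o A n).
  by move=> mD; apply: integrableS (bounded_prob_integrable (mA n) (AL n)).
have key i : (P (H i) <= (e^-1 * (L + `|c| + e))%:E * P (H i `&` E))%E.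
  have [_ ig gA] := ceg (k + i)%N (ltn_addr _ k0).
  have le1 : ((c + e + e)%:E * P (H i) <= \int[P]_(w in H i) (g (k + i)%N w)%:E)%E.
    rewrite -integral_cst//; apply: le_integral => //.
    - exact: finite_measure_integrable_cst.
    - exact: integrableS ig.
    - by move=> w /set_mem[/ltW]; rewrite lee_fin.
  have iI : P.-integrable (H i) (fun w => ((L + `|c| + e) * \1_E w)%:E).
    apply: integrableS (integrableZl measurableT (L + `|c| + e)
      (integrable_indic P mE)) => //.
  (* Off [E] the integrand is at most c + e. On [E] it is at most L, which is below (c + e) + (L +
     |c| + e) because c + |c| >= 0. *)
  have le2 : (\int[P]_(w in H i) (A (k + i)%N w)%:E <=
      (c + e)%:E * P (H i) + (L + `|c| + e)%:E * P (H i `&` E))%E.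
    rewrite -integral_cst//.
    rewrite [X in (_ <= _ + _ * P X)%E]setIC -integral_indic//.
    rewrite -integralZl//; last exact: integrableS (integrable_indic P mE).
    rewrite -integralD//; last exact: finite_measure_integrable_cst.
    apply: le_integral => //; first exact: iA.
      by apply: integrableD => //; exact: finite_measure_integrable_cst.
    move=> w _ /=; rewrite -EFinM -EFinD lee_fin indicE.
    have [/set_mem Ew|/negP] := boolP (w \in E).
      rewrite mulr1; have := AL (k + i)%N w; rewrite ler_norml => /andP[_ AwL].
      have := ler_norm (- c); rewrite normrN; lra.
    by rewrite inE mulr0 addr0 => /(AE _ _ (leq_addr _ _)).
  rewrite (gA _ (FH i)) in le1.
  have := le_trans le1 le2.
  have mHE : measurable (H i `&` E) by exact: measurableI.
  rewrite -(fineK (fin_num_measure P _ (mH i))).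
  rewrite -(fineK (fin_num_measure P _ mHE)).
  rewrite -!EFinM -EFinD !lee_fin => le.
  by rewrite -mulrA ler_pdivlMl//; lra.
rewrite -/G seqDU_bigcup_eq -/H measure_bigcup//; last exact: trivIset_seqDU.
apply: (@le_trans _ _ ((e^-1 * (L + `|c| + e))%:E *
    \sum_(0 <= i <oo | i \in setT) P (H i `&` E))%E).
  by rewrite -nneseriesZl//; apply: lee_nneseries => [i _ _|i _];
    [exact: measure_ge0|exact: key].
apply: lee_wpmul2l.
  by rewrite lee_fin mulr_ge0 ?invr_ge0 ?addr_ge0 ?(ltW e0).
rewrite -(@measure_bigcup _ _ _ P setT (fun i => H i `&` E)); last 2 first.
- by move=> i _; exact: measurableI.
- by apply: trivIset_setIr; exact: trivIset_seqDU.
apply: le_measure; rewrite ?inE//.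
  by apply: bigcup_measurable => i _; exact: measurableI.
by move=> w [i _ []].
Qed.

(** The tail events [E k] decrease to an event on which [A n] does not converge to c, so their
    probabilities tend to 0. The maximal inequality carries this over to the tail events [G k] of
    [g]. *)
Lemma cond_exp_eventually_le (A g : nat -> Om -> R) (L c e : R) : 0 < e ->
    (forall n, measurable_fun setT (A n)) -> (forall n w, `|A n w| <= L) ->
    (forall n, (0 < n)%N -> is_cond_exp P (F n) (A n) (g n)) ->
    {ae P, forall w, A n w @[n --> \oo] --> c} ->
  {ae P, forall w, exists k, forall n, (k <= n)%N -> g n w <= c + e + e}.
Proof.
move=> e0 mA AL ceg Ac.
(* The tails start at k + 1 because [g n] is a conditional expectation only for positive n. *)
pose E k := \bigcup_i [set w | c + e < A (k.+1 + i)%N w].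
pose G k := \bigcup_i [set w | c + e + e < g (k.+1 + i)%N w].
have mE k : measurable (E k).
  apply: bigcup_measurable => i _.
  rewrite (_ : [set _ | _] = A (k.+1 + i)%N @^-1` `]c + e, +oo[).
    by rewrite -[X in measurable X]setTI; exact: mA.
  by apply/seteqP; split=> w /=; rewrite in_itv/= andbT.
have mG k : measurable (G k).
  apply: bigcup_measurable => i _.
  rewrite (_ : [set _ | _] = g (k.+1 + i)%N @^-1` `]c + e + e, +oo[).
    have [Fg _ _] := ceg (k.+1 + i)%N isT.
    by apply: F_measurable; exact: Fg.
  by apply/seteqP; split=> w /=; rewrite in_itv/= andbT.
have PE : P (E k) @[k --> \oo] --> 0%E.
  have <- : P (\bigcap_k E k) = 0%E.
    apply/negligibleP; first exact: bigcapT_measurable.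
    apply: negligibleS Ac => w Ew Acw.
    have ce : c < c + e by rewrite ltrDl.
    have [m _ Hm] := cvgr_lt c Acw _ ce.
    have [i _ /=] := Ew m I; rewrite ltNge => /negP; apply.
    by apply/ltW/Hm => /=; rewrite addSn -addnS leq_addr.
  apply: nonincreasing_cvg_mu => //.
  - by rewrite -ge0_fin_numE// fin_num_measure.
  - exact: bigcapT_measurable.
  - move=> m n mn; apply/subsetPset => w [i _ /= Aw].
    by exists (n - m + i)%N => //=; rewrite addnA addSn subnKC.
have PG k : (P (\bigcap_k G k) <= (e^-1 * (L + `|c| + e))%:E * P (E k))%E.
  apply: (@le_trans _ _ (P (G k))).
    apply: le_measure; rewrite ?inE//; first exact: bigcapT_measurable.
    by move=> w; apply.
  apply: (cond_exp_maximal_ineq e0 _ (mE k) mA AL ceg) => // n w kn Ew.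
  rewrite leNgt; apply/negP => cA; apply: Ew; exists (n - k.+1)%N => //=.
  by rewrite subnKC.
have : P (\bigcap_k G k) = 0%E.
  apply/eqP; rewrite eq_le measure_ge0 andbT.
  have : ((e^-1 * (L + `|c| + e))%:E * P (E k))%E @[k --> \oo] --> 0%E.
    by rewrite -[X in _ --> X](mule0 (e^-1 * (L + `|c| + e))%:E); exact: cvgeZl.
  by apply: cvge_ge; near=> k; exact: PG.
move=> /negligibleP; move=> /(_ (bigcapT_measurable mG)).
apply: negligibleS => w /= /forallNP Gw k _.
have /existsNP[n /not_implyP[kn /negP]] := Gw k.+1.
by rewrite -ltNge => cg; exists (n - k.+1)%N => //=; rewrite subnKC.
Unshelve. all: by end_near. Qed.

(** The one-sided bound is applied to [A] and to -A with e = 1/(m+1) for every m. The negation is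
    written as multiplication by -1 so that [cond_expZ] applies. *)
Lemma cond_exp_cvg (A g : nat -> Om -> R) (L c : R) :
    (forall n, measurable_fun setT (A n)) -> (forall n w, `|A n w| <= L) ->
    (forall n, (0 < n)%N -> is_cond_exp P (F n) (A n) (g n)) ->
    {ae P, forall w, A n w @[n --> \oo] --> c} ->
  {ae P, forall w, g n w @[n --> \oo] --> c}.
Proof.
move=> mA AL ceg Ac.
have iA n : P.-integrable setT (EFin \o A n).
  exact: bounded_prob_integrable (mA n) (AL n).
have inv0 m : 0 < m.+1%:R^-1 :> R by rewrite invr_gt0.
have up m := cond_exp_eventually_le (inv0 m) mA AL ceg Ac.
have mN n : measurable_fun setT (fun w => -1 * A n w) by exact: measurable_funM.
have NL n w : `|-1 * A n w| <= L by rewrite mulN1r normrN.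
have ceN n : (0 < n)%N ->
    is_cond_exp P (F n) (fun w => -1 * A n w) (fun w => -1 * g n w).
  by move=> n0; apply: cond_expZ => //; exact: ceg.
have Nc : {ae P, forall w, -1 * A n w @[n --> \oo] --> - c}.
  by apply: filterS Ac => w Aw; rewrite -[X in _ --> X]mulN1r;
    exact: cvgM (cvg_cst _) Aw.
have lo m := cond_exp_eventually_le (inv0 m) mN NL ceN Nc.
apply: filterS2 (ae_foralln up) (ae_foralln lo) => w {}up {}lo.
apply/cvgrPdist_le => e e0.
(* The one-sided bounds exceed the limit by 2/(m+1), hence the choice 1/(m+1) <= e/2. *)
have [m me] : exists m : nat, m.+1%:R^-1 <= e / 2.
  have e20 : 0 < e / 2 by rewrite divr_gt0.
  have [m _ /(_ m (leqnn m))/= me] := near_infty_natSinv_lt (PosNum e20).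
  by exists m; exact: ltW.
have [k1 Hk1] := up m; have [k2 Hk2] := lo m.
exists (maxn k1 k2) => // n /=; rewrite geq_max => /andP[kn1 kn2].
have := Hk1 _ kn1; have := Hk2 _ kn2; rewrite mulN1r ler_distl.
move: me; move: (m.+1%:R^-1) => i me lo1 up1.
by apply/andP; split; lra.
Qed.

Lemma bounded_cvg_L1 (A : nat -> Om -> R) (L c : R) :
    (forall n, measurable_fun setT (A n)) -> (forall n w, `|A n w| <= L) ->
    {ae P, forall w, A n w @[n --> \oo] --> c} ->
  ('E_P[fun w => `|A n w - c|%R] @[n --> \oo] --> 0)%E /\
  ('E_P[A n] @[n --> \oo] --> c%:E)%E.
Proof.
move=> mA AL Ac.
have [] := @dominated_convergence _ _ _ P setT measurableT
  (fun n => EFin \o A n) (cst c%:E) (cst L%:E).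
- by move=> n; exact/measurable_EFinP.
- exact: measurable_cst.
- by apply: filterS Ac => w Aw _; apply: cvg_EFin => //; exact: nearW.
- exact: finite_measure_integrable_cst.
- by apply: aeW => w n _ /=; rewrite lee_fin.
move=> _ L1 E1; split.
  apply: cvg_trans L1; apply: near_eq_cvg; apply: nearW => n.
  by rewrite unlock; apply: eq_integral => w _.
move: E1; rewrite integral_cst// [X in (_ * X)%E](probability_setT P) mule1.
by apply: cvg_trans; apply: near_eq_cvg; apply: nearW => n; rewrite unlock.
Qed.

Lemma cond_exp_cvg_as_L1 (A g : nat -> Om -> R) (L c : R) :
    (forall n, measurable_fun setT (A n)) -> (forall n w, `|A n w| <= L) ->
    (forall n, (0 < n)%N -> is_cond_exp P (F n) (A n) (g n)) ->
    {ae P, forall w, A n w @[n --> \oo] --> c} ->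
  [/\ cvg_as_L1 P A c, cvg_as_L1 P g c
    & ('E_P[g n] @[n --> \oo] --> c%:E)%E].
Proof.
move=> mA AL ceg Ac.
have [L1 E1] := bounded_cvg_L1 mA AL Ac.
have iA n : P.-integrable setT (EFin \o A n).
  exact: bounded_prob_integrable (mA n) (AL n).
split; first by split.
- split; first exact: cond_exp_cvg ceg Ac.
  apply: squeeze_cvge (cvg_cst 0%E) L1.
  near=> n; apply/andP; split.
    by rewrite unlock; apply: integral_ge0 => w _; rewrite lee_fin.
  apply: (@cond_exp_L1_contraction (F n)) => //.
  by apply: ceg; near: n; exact: nbhs_infty_gt.
- apply: cvg_trans E1; apply: near_eq_cvg; near=> n.
  have n0 : (0 < n)%N by near: n; exact: nbhs_infty_gt.
  have [_ _ gA] := ceg n n0; rewrite unlock gA//.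
  (* The whole space, as the complement of the empty set, lies in [F n]. Integrating over it gives E
     g_n = E A_n. *)
  have [F0 FC _] := F_sigma n.
  by have := FC _ F0; rewrite setD0.
Unshelve. all: by end_near. Qed.

End hunt.

(** * The filtration generated by the observations *)

Section observations_sigma_algebra.
Context {d d'} {Om : measurableType d} {T : measurableType d'}.
Variable X : nat -> Om -> T.
Hypothesis mX : forall t, measurable_fun setT (X t).

Lemma measurable_first_n n : measurable_fun setT (first_n X n).
Proof.
apply/measurable_fun_tnthP => i.
rewrite (_ : _ \o _ = X i); first exact: mX.
by apply/funext => w /=; rewrite tnth_mktuple.
Qed.

Lemma sigma_first_n_sigma_algebra n : sigma_algebra setT (sigma_first_n X n).
Proof. exact/sigma_algebra_preimage/sigma_algebra_measurable. Qed.

Lemma sigma_first_n_measurable n : sigma_first_n X n `<=` measurable.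
Proof. by move=> _ [B mB <-]; exact: measurable_first_n. Qed.

Lemma sigma_first_n_preimage {d2} {U : measurableType d2} n
    (h : n.-tuple T -> U) (B : set U) : measurable_fun setT h -> measurable B ->
  sigma_first_n X n ((h \o first_n X n) @^-1` B).
Proof.
move=> mh mB; exists (h @^-1` B); last by rewrite setTI.
by rewrite -[X in measurable X]setTI; exact: mh.
Qed.

Lemma sigma_first_n_mono m n : (m <= n)%N ->
  sigma_first_n X m `<=` sigma_first_n X n.
Proof.
move=> mn _ [B mB <-]; rewrite setTI.
pose h (t : n.-tuple T) : m.-tuple T := [tuple tnth t (widen_ord mn i) | i < m].
have -> : first_n X m @^-1` B = (h \o first_n X n) @^-1` B.
  congr (_ @^-1` B); apply/funext => w; apply: eq_from_tnth => i /=.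
  by rewrite !tnth_mktuple.
apply: sigma_first_n_preimage => //.
apply/measurable_fun_tnthP => i.
rewrite (_ : _ \o _ = (@tnth _ _)^~ (widen_ord mn i)).
  exact: measurable_tnth.
by apply/funext => t /=; rewrite tnth_mktuple.
Qed.

End observations_sigma_algebra.

(** * Strong law for the cycles of a regenerative process *)

Lemma measurable_fun_nat_index {d1 d2} {T1 : measurableType d1}
    {T2 : measurableType d2} (n : T1 -> nat) (f : nat -> T1 -> T2) :
  measurable_fun setT n -> (forall k, measurable_fun setT (f k)) ->
  measurable_fun setT (fun w => f (n w) w).
Proof.
move=> mn mf _ B mB; rewrite setTI.
have -> : (fun w => f (n w) w) @^-1` B =
    \bigcup_k (n @^-1` [set k] `&` f k @^-1` B).
  apply/seteqP; split=> [w Bw|w [k _ [/= <-]]//].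
  by exists (n w).
apply: bigcup_measurable => k _; apply: measurableI.
  by rewrite -[X in measurable X]setTI; exact: mn.
by rewrite -[X in measurable X]setTI; exact: mf.
Qed.

Definition coord_sets {d} (E : measurableType d) : set (set (nat -> E * nat)) :=
  [set A | exists t, exists2 B, measurable B & A = (fun z => z t) @^-1` B].

Arguments coord_sets {d} E.

Local Notation path E := (g_sigma_algebraType (coord_sets E)).

(* For [z = shifted Z S k w], [path_sum B a c n z] is the sum over the cycles
   k + 1, ..., k + n of [a] times the number of visits of [Z] to [B] minus [c]. *)
Definition path_sum {E : Type} {R : realType} (B : set E) (a c : R) (n : nat)
    (z : nat -> E * nat) : R :=
  a * (\sum_(0 <= i < (z n).2) \1_B (z i).1) - c * n%:R.

(** The initial value 0 stands for the empty sum, which is [path_sum] at 0 on every shifted path. *)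
Fixpoint path_max {E : Type} {R : realType} (B : set E) (a c : R) (n : nat)
    (z : nat -> E * nat) : R :=
  if n is n'.+1 then Num.max (path_max B a c n' z) (path_sum B a c n z) else 0.

Section path_space.
Context {dE} {E : measurableType dE} {R : realType}.
Variables (B : set E) (a c : R).
Hypothesis mB : measurable B.

Lemma measurable_path_coord t : measurable_fun setT (fun z : path E => z t).
Proof.
by move=> _ A mA; rewrite setTI; apply: sub_sigma_algebra; exists t, A.
Qed.

Lemma measurable_path_sum n :
  measurable_fun setT (path_sum B a c n : path E -> R).
Proof.
apply: measurable_funB => //; apply: measurable_funM => //.
apply: (@measurable_fun_nat_index _ _ (path E) R (fun z => (z n).2)
  (fun k z => \sum_(0 <= i < k) \1_B (z i).1)).
  by apply: measurableT_comp; [exact: measurable_snd|exact: measurable_path_coord].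
move=> k; apply: measurable_sum => i.
apply: measurableT_comp; first exact: measurable_indic.
by apply: measurableT_comp; [exact: measurable_fst|exact: measurable_path_coord].
Qed.

Lemma measurable_path_max n :
  measurable_fun setT (path_max B a c n : path E -> R).
Proof.
elim: n => [|n IHn] //=.
by apply: measurable_maxr => //; exact: measurable_path_sum.
Qed.

Lemma path_max_ge0 n z : 0 <= path_max B a c n z.
Proof. by elim: n => [|n IHn] //=; rewrite le_max IHn. Qed.

Lemma path_max_nondecreasing m n z : (m <= n)%N ->
  path_max B a c m z <= path_max B a c n z.
Proof.
have := @homo_leq _ (path_max B a c ^~ z) <=%O (@lexx _ _) (@le_trans _ _).
by apply=> k /=; rewrite le_max lexx.
Qed.

End path_space.

(** * Cycle sums with negative drift are bounded above *)

Section regenerative.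
Context {d dE} {Om : measurableType d} {E : measurableType dE} {R : realType}.
Variables (P : probability Om R) (Z : nat -> Om -> E).
Variable S : nat -> {RV P >-> nat}.
Hypotheses (regZ : classical_regenerative Z S) (recS : positive_recurrent S).

Lemma measurable_shifted k : measurable_fun setT (shifted Z S k : Om -> path E).
Proof.
apply: (@measurability _ _ Om (path E) setT (shifted Z S k) (coord_sets E)) => //.
move=> _ [_ [t [B mB ->]] <-].
rewrite setTI.
pose f w := (Z (S k w + t)%N w, (S (k + t) w - S k w)%N).
rewrite (_ : _ @^-1` _ = f @^-1` B)//.
rewrite -[X in measurable X]setTI.
apply: (_ : measurable_fun setT f) => //.
apply/measurable_fun_pair.
  apply: (@measurable_fun_nat_index _ _ _ _ (fun w => S k w + t)%N Z).
    exact: measurable_fun_addn.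
  exact: reg_measurable regZ.
exact: measurable_fun_subn.
Qed.

Lemma renewal_le w m n : (forall k, (S k w < S k.+1 w)%N) ->
  (m <= n)%N -> (S m w <= S n w)%N.
Proof.
move=> gw; have := @homo_leq _ (fun k => S k w) leq leqnn leq_trans.
by apply=> k; exact: ltnW.
Qed.

Variables (B : set E) (a c : R).
Hypothesis mB : measurable B.

Lemma path_sum0 k w : path_sum B a c 0 (shifted Z S k w) = 0.
Proof.
by rewrite /path_sum /= addn0 subnn big_geq// !mulr0 subr0.
Qed.

Lemma path_sum_le_max n k w :
  path_sum B a c n (shifted Z S k w) <= path_max B a c n (shifted Z S k w).
Proof.
by case: n => [|n] /=; rewrite ?path_sum0// le_max lexx orbT.
Qed.

(** The time interval is cut at the renewal S_1. Monotonicity of the renewal times makes the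
    truncated subtractions genuine differences. *)
Lemma path_sum_shift n w : (forall k, (S k w < S k.+1 w)%N) ->
  path_sum B a c n.+1 (shifted Z S 0 w) =
  path_sum B a c 1 (shifted Z S 0 w) + path_sum B a c n (shifted Z S 1 w).
Proof.
move=> gw; rewrite /path_sum /= !add0n add1n.
have le01 : (S 0 w <= S 1 w)%N by exact: renewal_le.
have le1n : (S 1 w <= S n.+1 w)%N by exact: renewal_le.
rewrite (@big_cat_nat _ _ _ (S 1 w - S 0 w))//=; last exact: leq_sub2r.
rewrite -{2}[(S 1 w - S 0 w)%N]add0n big_addn.
rewrite (_ : S n.+1 w - S 0 w - (S 1 w - S 0 w) = S n.+1 w - S 1 w)%N; last lia.
rewrite [X in a * (_ + X)](eq_bigr (fun i => \1_B (Z (S 1 w + i)%N w))).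
  by rewrite -[n.+1%:R]natr1; ring.
by move=> i _; congr (\1_B (Z _ w)); lia.
Qed.

Lemma path_max_shift n w : (forall k, (S k w < S k.+1 w)%N) ->
  path_max B a c n.+1 (shifted Z S 0 w) =
  Num.max 0
    (path_sum B a c 1 (shifted Z S 0 w) + path_max B a c n (shifted Z S 1 w)).
Proof.
move=> gw; elim: n => [|n IHn]; first by rewrite /= addr0.
rewrite -[LHS]/(Num.max (path_max B a c n.+1 (shifted Z S 0 w))
                        (path_sum B a c n.+2 (shifted Z S 0 w))).
by rewrite IHn (path_sum_shift n.+1)// -maxA -addr_maxr.
Qed.

(** Both sides are integrals against the law of the shifted process on path space, and [reg_law]
    says that this law is the same for both shifts. *)
Lemma shifted_integral (D : set (path E)) (h : path E -> \bar R) :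
    measurable D -> measurable_fun setT h -> (forall z, (0 <= h z)%E) ->
  (\int[P]_(w in shifted Z S 1 @^-1` D) h (shifted Z S 1 w) =
   \int[P]_(w in shifted Z S 0 @^-1` D) h (shifted Z S 0 w))%E.
Proof.
move=> mD mh h0.
pose sh k : {mfun Om >-> path E} := HB.pack (shifted Z S k : Om -> path E)
  (isMeasurableFun.Build _ _ _ _ _ (measurable_shifted k)).
have pf k : (\int[P]_(w in shifted Z S k @^-1` D) h (shifted Z S k w) =
    \int[distribution P (sh k)]_(z in D) h z)%E.
  rewrite (ge0_integral_pushforward (measurable_shifted k))//.
  exact: measurable_funTS.
rewrite !pf; apply: eq_measure_integral => A mA _.
exact: reg_law regZ 1%N A mA.
Qed.

(** As [Z i] is Z_{i+1}, the indices from [S 0] to [S 1] - 1 are the times S_0 + 1, ..., S_1 of the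
    first full cycle. *)
Definition cycle_visits (B : set E) (w : Om) : R :=
  \sum_(S 0 w <= i < S 1 w) \1_B (Z i w).

Lemma path_sumE n w : path_sum B a c n (shifted Z S 0 w) =
  a * (\sum_(S 0 w <= i < S n w) \1_B (Z i w)) - c * n%:R.
Proof.
rewrite /path_sum; congr (a * _ - _).
rewrite -[X in _ = \sum_(X <= _ < _) _]add0n big_addn.
by apply: eq_bigr => i _; rewrite addnC.
Qed.

(** A visit to [B] at index t during the first cycle. The count of visits is the series of these
    indicators, and each event is determined by the past of S_1. *)
Let C t : set Om := [set w | (S 0 w <= t < S 1 w)%N /\ B (Z t w)].

Let visits_series w :
  (cycle_visits B w)%:E = (\sum_(0 <= t <oo) (\1_(C t) w)%:E)%E.
Proof.
apply/esym/lim_near_cst => //; near=> n.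
have Sn : (S 1 w <= n)%N by near: n; exact: nbhs_infty_ge.
rewrite sumEFin /cycle_visits (big_nat_widen _ _ _ _ _ Sn).
rewrite (big_nat_widenl _ _ _ _ _ (leq0n (S 0 w))) [in RHS]big_mkcond.
congr EFin; apply: eq_bigr => t _; rewrite /= !indicE.
case: ifPn => [/andP[tS1 S0t]|tS].
  congr (_%:R : R); congr nat_of_bool.
  apply/idP/idP => /set_mem h; apply/mem_set.
    by case: h.
  by split => //; rewrite S0t.
rewrite memNset// => -[/andP[h1 h2] _]; move: tS.
by rewrite h1 h2.
Unshelve. all: by end_near. Qed.

Let C_past t : past_sigma Z S 1 (C t).
Proof.
(* [G] repeats the generators of the past, so that [C t] can be built inside the sigma-algebra they
   generate: {S_0 <= t} is a union of the events {S_0 = i}, and the remaining condition is itself a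
   generator. *)
pose G : set (set Om) := [set A |
  (exists j i, (j <= 1)%N /\ A = [set w | S j w = i]) \/
  (exists t, exists2 B, measurable B & A = [set w | (t < S 1 w)%N /\ B (Z t w)])].
rewrite (_ : C t = (\bigcup_(i in [set i | (i <= t)%N]) [set w | S 0 w = i]) `&`
    [set w | (t < S 1 w)%N /\ B (Z t w)]); last first.
  apply/seteqP; split=> w.
    by case=> /andP[S0t tS1] Bw; split; [exists (S 0 w)|].
  by move=> [[i /= it Si] [tS1 Bw]]; split => //; rewrite Si it.
apply: (@measurableI _ (g_sigma_algebraType G)).
  apply: (@bigcup_measurable _ (g_sigma_algebraType G)) => i _.
  by apply: sub_sigma_algebra; left; exists 0%N, i.
by apply: sub_sigma_algebra; right; exists t, B.
Qed.

Let measurable_C t : measurable (C t).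
Proof.
rewrite (_ : C t = (fun w => (S 0 w <= t)%N) @^-1` [set true] `&`
   ((fun w => (t < S 1 w)%N) @^-1` [set true] `&` Z t @^-1` B)); last first.
  apply/seteqP; split=> w /=.
    by case=> /andP[-> ->].
  by move=> [S0t [tS1 Bw]]; split => //; apply/andP.
apply: measurableI; last apply: measurableI.
- rewrite -[X in measurable X]setTI.
  by apply: measurable_fun_leq.
- rewrite -[X in measurable X]setTI.
  by apply: measurable_fun_ltn.
- by rewrite -[X in measurable X]setTI; apply: (reg_measurable regZ).
Qed.

Lemma measurable_cycle_visits : measurable_fun setT (cycle_visits B).
Proof.
apply/measurable_EFinP.
rewrite (_ : _ \o _ = (fun w => \sum_(0 <= t <oo) (\1_(C t) w)%:E)%E); last first.
  by apply/funext => w /=; rewrite visits_series.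
apply: (@ge0_emeasurable_sum _ _ _ setT _ predT) => // t _.
by apply/measurable_EFinP/measurable_indic.
Qed.

Lemma cycle_visits_ge0 w : 0 <= cycle_visits B w.
Proof. exact: sumr_ge0. Qed.

Lemma cycle_visits_le w : cycle_visits B w <= (S 1 w - S 0 w)%:R.
Proof.
rewrite -[(_ - _)%N]muln1 -sum_nat_const_nat natr_sum.
by apply: ler_sum => i _; rewrite indicE; case: (_ \in _).
Qed.

Lemma integrable_cycle_visits : P.-integrable setT (EFin \o cycle_visits B).
Proof.
apply: (@le_integrable _ _ _ P setT measurableT _
  (EFin \o (fun w => (S 1 w - S 0 w)%:R : R))).
- by apply/measurable_EFinP; exact: measurable_cycle_visits.
- move=> w _ /=; rewrite !ger0_norm ?cycle_visits_ge0// lee_fin.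
  exact: cycle_visits_le.
- apply/integrableP; split.
    apply/measurable_EFinP/(measurableT_comp (f := fun n => n%:R : R)) => //.
    exact: measurable_fun_subn.
  move: recS; rewrite /positive_recurrent unlock; apply: le_lt_trans.
  by rewrite le_eqVlt; apply/orP; left; apply/eqP/eq_integral => w _ /=;
    rewrite ger0_norm.
Qed.

(** Expanding the visits into the events [C t] of the past of S_1, [reg_indep] factors every term of
    the series. *)
Lemma integral_cycle_visits_indep (D : set (path E)) : measurable D ->
  (\int[P]_(w in shifted Z S 1 @^-1` D) (cycle_visits B w)%:E =
   P (shifted Z S 1 @^-1` D) * \int[P]_w (cycle_visits B w)%:E)%E.
Proof.
move=> mD; set A := _ @^-1` D.
have mA : measurable A.
  by rewrite -[X in measurable X]setTI; exact: measurable_shifted.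
have series A' : measurable A' -> (\int[P]_(w in A') (cycle_visits B w)%:E =
    \sum_(0 <= t <oo) P (C t `&` A'))%E.
  move=> mA'; under eq_integral do rewrite visits_series.
  rewrite integral_nneseries//; last first.
    by move=> t; apply/measurable_EFinP/measurable_indic.
  by apply: eq_eseriesr => t _; rewrite integral_indic.
rewrite !series// -(fineK (fin_num_measure P _ mA)) -nneseriesZl//.
apply: eq_eseriesr => t _; rewrite setIT (reg_indep regZ (C_past t) mD) muleC.
by rewrite fineK// fin_num_measure.
Qed.

Let xi w := a * cycle_visits B w - c.

Let unbounded : set (path E) :=
  [set z | forall K : nat, exists n, K%:R < path_sum B a c n z].

Let measurable_unbounded : measurable unbounded.
Proof.
rewrite (_ : unbounded = \bigcap_K \bigcup_n
    ((path_sum B a c n : path E -> R) @^-1` `]K%:R, +oo[)); last first.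
  apply/seteqP; split=> z.
    by move=> uz K _; have [n Kn] := uz K; exists n; rewrite //= in_itv/= Kn.
  move=> uz K; have [n _] := uz K I; rewrite /= in_itv/= andbT => Kn.
  by exists n.
apply: bigcapT_measurable => K; apply: bigcupT_measurable => n.
rewrite -[X in measurable X]setTI; exact: measurable_path_sum.
Qed.

Let good w := forall k, (S k w < S k.+1 w)%N.

Let good_ae : {ae P, forall w, good w}.
Proof. exact: reg_increasing regZ. Qed.

Let path_sumS n w : good w ->
  path_sum B a c n.+1 (shifted Z S 0 w) =
  xi w + path_sum B a c n (shifted Z S 1 w).
Proof. by move=> gw; rewrite path_sum_shift// path_sumE mulr1. Qed.

Let path_maxS n w : good w ->
  path_max B a c n.+1 (shifted Z S 0 w) =
  Num.max 0 (xi w + path_max B a c n (shifted Z S 1 w)).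
Proof. by move=> gw; rewrite path_max_shift// path_sumE mulr1. Qed.

(** The two sequences of partial sums differ by the fixed number [xi w] and an index shift. Asking
    for the level K + b, with b bounding |xi|, absorbs the difference. *)
Let unbounded_shift w : good w ->
  unbounded (shifted Z S 0 w) <-> unbounded (shifted Z S 1 w).
Proof.
move=> gw.
have [b bP] : exists b : nat, `|xi w| <= b%:R.
  by exists (Num.bound `|xi w|); apply/ltW/archi_boundP.
move: bP; rewrite ler_norml => /andP[b1 b2].
split=> uw K; have := uw (K + b)%N; rewrite natrD.
- case=> -[|n]; first by rewrite path_sum0 => h; exfalso;
    have := ler0n R K; have := ler0n R b; lra.
  by rewrite path_sumS// => h; exists n; lra.
- by case=> n h; exists n.+1; rewrite path_sumS//; lra.
Qed.

Let measurable_shiftedP (D : set (path E)) k : measurable D ->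
  measurable (shifted Z S k @^-1` D).
Proof.
by move=> mD; rewrite -[X in measurable X]setTI; exact: measurable_shifted.
Qed.

Let measurable_max n k :
  measurable_fun setT (fun w => path_max B a c n (shifted Z S k w)).
Proof.
apply: (measurableT_comp (measurable_path_max a c mB n)).
exact: measurable_shifted.
Qed.

Let integrable_xi : P.-integrable setT (EFin \o xi).
Proof.
have := integrableB measurableT
  (integrableZl measurableT a integrable_cycle_visits)
  (finite_measure_integrable_cst P c measurableT).
by apply: eq_integrable.
Qed.

(** Induction on n: the recursion bounds the next maximum by |xi| plus the maximum of the shifted
    path, which has the same law as the unshifted one. *)
Let integrable_max n k : (k <= 1)%N ->
  P.-integrable setT (fun w => (path_max B a c n (shifted Z S k w))%:E).
Proof.
have one m : P.-integrable setT (fun w => (path_max B a c m (shifted Z S 0 w))%:E) ->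
    P.-integrable setT (fun w => (path_max B a c m (shifted Z S 1 w))%:E).
  move=> /integrableP[_ im]; apply/integrableP; split.
    by apply/measurable_EFinP; exact: measurable_max.
  have := @shifted_integral setT (fun z => `|(path_max B a c m z)%:E|)%E.
  rewrite !preimage_setT => -> //.
  by do 2 apply: measurableT_comp => //; exact: measurable_path_max.
have zero m : P.-integrable setT (fun w => (path_max B a c m (shifted Z S 0 w))%:E).
  elim: m => [|m IHm]; first exact: integrable0.
  apply/integrableP; split; first by apply/measurable_EFinP; exact: measurable_max.
  have /integrableP[mD] := integrableD measurableT
    (integrable_abse integrable_xi) (one _ IHm).
  apply: le_lt_trans; apply: ae_ge0_le_integral => //.
  - by do 2 apply: measurableT_comp => //; exact: measurable_max.
  - exact: measurableT_comp.
  apply: filterS good_ae => w gw _; rewrite path_maxS//=.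
  rewrite lee_fin [X in _ <= X]ger0_norm ?addr_ge0 ?path_max_ge0//.
  rewrite ger0_norm ?le_max ?lexx//.
  rewrite ge_max addr_ge0 ?path_max_ge0//=.
  by rewrite lerD2r ler_norm.
by case: k => [|[|]] // _; exact/one/zero.
Qed.

Let increment n w := path_max B a c n.+1 (shifted Z S 0 w) -
  path_max B a c n (shifted Z S 1 w).

(** Equality of laws replaces the subtracted integral by that of M_n over the unshifted event. The
    two events agree almost surely by [unbounded_shift], and M_n <= M_(n+1). *)
Let integral_increment_ge0 n :
  (0 <= \int[P]_(w in shifted Z S 1 @^-1` unbounded) (increment n w)%:E)%E.
Proof.
set A1 := _ @^-1` _.
have mA k : measurable (shifted Z S k @^-1` unbounded).
  exact: measurable_shiftedP.
have iM m k (D : set Om) : (k <= 1)%N -> measurable D ->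
    P.-integrable D (fun w => (path_max B a c m (shifted Z S k w))%:E).
  by move=> k1 mD; apply: integrableS (integrable_max _ k1).
under eq_integral do rewrite EFinB.
rewrite (integralB_EFin (mA 1%N)); last 2 first.
- exact: (iM n.+1 0%N A1 isT (mA 1%N)).
- exact: (iM n 1%N A1 isT (mA 1%N)).
rewrite sube_ge0; last first.
  by rewrite (integrable_fin_num (mA 1%N) (iM n 1%N A1 isT (mA 1%N))).
rewrite (@shifted_integral unbounded (fun z => (path_max B a c n z)%:E))//;
  last 2 first.
- by apply/measurable_EFinP; exact: measurable_path_max.
- by move=> z; rewrite lee_fin path_max_ge0.
rewrite [leRHS](_ : _ = \int[P]_(w in shifted Z S 0 @^-1` unbounded)
    (path_max B a c n.+1 (shifted Z S 0 w))%:E)%E; last first.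
  rewrite integral_mkcond [RHS]integral_mkcond.
  have mM : measurable_fun setT
      (fun w => (path_max B a c n.+1 (shifted Z S 0 w))%:E).
    by apply/measurable_EFinP; exact: measurable_max.
  apply: ae_eq_integral => //.
  - by apply/(measurable_restrictT _ (mA 1%N)); exact: measurable_funTS.
  - by apply/(measurable_restrictT _ (mA 0%N)); exact: measurable_funTS.
  apply: filterS good_ae => w gw _; rewrite !patchE.
  suff -> : (w \in A1) = (w \in shifted Z S 0 @^-1` unbounded) by [].
  by apply/idP/idP => /set_mem h; apply/mem_set/(unbounded_shift gw).
apply: le_integral => //.
- exact: (iM n 0%N _ isT (mA 0%N)).
- exact: (iM n.+1 0%N _ isT (mA 0%N)).
by move=> w _; rewrite lee_fin path_max_nondecreasing.
Qed.

(** Once the maximum over the later cycles exceeds |xi|, the maximum with 0 in the recursion is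
    inactive and the increment equals [xi w] exactly. *)
Let increment_cvg w : good w -> unbounded (shifted Z S 1 w) ->
  (increment n w)%:E @[n --> \oo] --> (xi w)%:E.
Proof.
move=> gw uw; apply: cvg_near_cst.
have [b bP] : exists b : nat, `|xi w| <= b%:R.
  by exists (Num.bound `|xi w|); apply/ltW/archi_boundP.
have [n0 n0P] := uw b.
near=> n.
have n0n : (n0 <= n)%N by near: n; exact: nbhs_infty_ge.
congr EFin; rewrite /increment path_maxS// (max_idPr _) ?addrK//.
have le1 : b%:R <= path_max B a c n (shifted Z S 1 w).
  apply: le_trans (ltW n0P) _.
  apply: (@le_trans _ _ (path_max B a c n0 (shifted Z S 1 w))).
    exact: path_sum_le_max.
  exact: path_max_nondecreasing.
by move: bP; rewrite ler_norml => /andP[? ?]; lra.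
Unshelve. all: by end_near. Qed.

(** The dominating bound: the increment is either xi, or -m with 0 <= m < -xi, where m is the
    maximum over the later cycles. *)
Let increment_le n w : good w -> (`|(increment n w)%:E| <= `|(xi w)%:E|)%E.
Proof.
move=> gw; rewrite -[leLHS]/(`|increment n w|%:E) -[leRHS]/(`|xi w|%:E).
rewrite lee_fin /increment path_maxS//.
have := path_max_ge0 B a c n (shifted Z S 1 w).
move: (path_max _ _ _ _ _) => m m0.
have [h|h] := leP 0 (xi w + m); first by rewrite addrK.
by rewrite sub0r normrN (ger0_norm m0) ler0_norm; lra.
Qed.

Lemma path_sum_bounded_above :
  a * fine (\int[P]_w (cycle_visits B w)%:E) < c ->
  {ae P, forall w, exists K : R, forall n, path_sum B a c n (shifted Z S 0 w) <= K}.
Proof.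
move=> drift; set A := shifted Z S 1 @^-1` unbounded.
have mA : measurable A by exact: measurable_shiftedP.
have xiA : (0 <= \int[P]_(w in A) (xi w)%:E)%E.
  have [] := @dominated_convergence _ _ _ P A mA
    (fun n w => (increment n w)%:E) (EFin \o xi) (abse \o (EFin \o xi)).
  - move=> n; apply/measurable_funTS/measurable_EFinP.
    by apply: measurable_funB; exact: measurable_max.
  - by apply: measurable_funTS; case/integrableP: integrable_xi.
  - by apply: filterS good_ae => w gw Aw; exact: increment_cvg.
  - by apply: integrableS (integrable_abse integrable_xi).
  - by apply: filterS good_ae => w gw n _; exact: increment_le.
  move=> _ _; apply: cvge_ge; near=> n; exact: integral_increment_ge0.
have iN : P.-integrable A (EFin \o cycle_visits B).
  exact: integrableS integrable_cycle_visits.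
have iN_fin := integrable_fin_num measurableT integrable_cycle_visits.
(* The event [A] concerns the cycles after S_1 only, so by independence the integral of xi over it
   is P(A) times the drift. The drift being negative, [xiA] forces P(A) = 0. *)
have xiE : (\int[P]_(w in A) (xi w)%:E =
    (fine (P A) * (a * fine (\int[P]_w (cycle_visits B w)%:E) - c))%:E)%E.
  rewrite (_ : integral _ _ _ =
      \int[P]_(w in A) (a%:E * (cycle_visits B w)%:E - (cst c w)%:E))%E; last first.
    by apply: eq_integral => w _; rewrite -EFinM -EFinB.
  have iaN := integrableZl mA a iN.
  rewrite (integralB_EFin (f1 := fun w => a * cycle_visits B w)%R)//; last first.
    exact: finite_measure_integrable_cst.
  under eq_integral do rewrite EFinM.
  rewrite integralZl// integral_cycle_visits_indep//.
  have -> : (\int[P]_(w in A) (cst c w)%:E = c%:E * P A)%E by rewrite -integral_cst.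
  rewrite -/A -{1}(fineK iN_fin).
  rewrite -(fineK (fin_num_measure P _ mA)) -!EFinM -EFinB; congr EFin => /=.
  ring.
have PA0 : P A = 0%E.
  apply/eqP; rewrite eq_le measure_ge0 andbT.
  rewrite -(fineK (fin_num_measure P _ mA)) lee_fin.
  move: xiA; rewrite xiE lee_fin; rewrite leNgt => /negP h.
  by rewrite leNgt; apply/negP => PA; apply: h; rewrite pmulr_rlt0// subr_lt0.
have : P.-negligible A by apply/negligibleP.
move=> A0; have nA : {ae P, forall w, ~ A w}.
  by apply: negligibleS A0 => w /= /contrapT.
apply: filterS2 good_ae nA => w gw nAw.
apply: contrapT => /forallNP unb; apply: nAw.
apply/(unbounded_shift gw) => K.
have /existsNP[n /negP] := unb K%:R.
by rewrite -ltNge => Kn; exists n.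
Unshelve. all: by end_near. Qed.

End regenerative.

Section visits_slln.
Context {d dE} {Om : measurableType d} {E : measurableType dE} {R : realType}.
Variables (P : probability Om R) (Z : nat -> Om -> E).
Variable S : nat -> {RV P >-> nat}.
Hypotheses (regZ : classical_regenerative Z S) (recS : positive_recurrent S).

Lemma visits_slln (B : set E) : measurable B ->
  {ae P, forall w, (\sum_(S 0 w <= i < S n w) \1_B (Z i w)) / n%:R @[n --> \oo] -->
    fine (\int[P]_w (cycle_visits Z S B w)%:E)}.
Proof.
move=> mB; set nu := fine _.
have inv0 m : 0 < m.+1%:R^-1 :> R by rewrite invr_gt0.
(* Slopes slightly above the mean: a = 1 bounds the number of visits from above by n (nu + 1/(m+1))
   plus a constant, and a = -1 bounds it from below in the same way. *)
have up m : 1 * nu < nu + m.+1%:R^-1 by rewrite mul1r ltrDl.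
have lo m : -1 * nu < m.+1%:R^-1 - nu by rewrite mulN1r ltrDr.
have {}up m := path_sum_bounded_above regZ recS mB (up m).
have {}lo m := path_sum_bounded_above regZ recS mB (lo m).
apply: filterS2 (ae_foralln up) (ae_foralln lo) => w {}up {}lo.
apply/cvgrPdist_le => e e0.
have e20 : 0 < e / 2 by rewrite divr_gt0.
have [m _ /(_ m (leqnn m))/= me] := near_infty_natSinv_lt (PosNum e20).
have [K1 K1P] := up m; have [K2 K2P] := lo m.
move: me K1P K2P; move: (m.+1%:R^-1) => i ie K1P K2P.
near=> n.
have n0 : 0 < n%:R :> R by rewrite ltr0n; near: n; exact: nbhs_infty_gt.
(* Half of the tolerance pays for the constants K1 and K2 once n is large, the other half for the
   excess slope 1/(m+1). *)
have nK : `|K1| + `|K2| <= e / 2 * n%:R.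
  rewrite -ler_pdivrMl//; near: n; exact: nbhs_infty_ger.
have := K1P n; have := K2P n; rewrite !path_sumE.
move: (\sum_(_ <= _ < _) _) => x le1 le2.
have in0 : i * n%:R <= e / 2 * n%:R by rewrite ler_pM2r// ltW.
have h1 := ler_norm K1; have h2 := ler_norm K2.
have h3 := normr_ge0 K1; have h4 := normr_ge0 K2.
have xE : x = x / n%:R * n%:R by rewrite divfK ?gt_eqF.
move: xE; move: (x / _) => y xE; move: le1 le2; rewrite xE => le1 le2.
by rewrite ler_distl; apply/andP; split; rewrite -(ler_pM2r n0); lra.
Unshelve. all: by end_near. Qed.

End visits_slln.

(** * Averages along a renewal sequence *)

Section renewal_average.
Context {R : realType}.
Variables (s : nat -> nat) (m : nat) (b : nat -> R) (bn : forall n, 'I_n -> R).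
Arguments bn : clear implicits.
Hypotheses (s_lt : forall k, (s k < s k.+1)%N)
  (b01 : forall i, 0 <= b i <= 1) (bn01 : forall n i, 0 <= bn n i <= 1)
  (bnE : forall j n, (s j + m <= n)%N -> forall i : 'I_n, (i < s j)%N ->
           bn n i = b i).

Let s_le i j : (i <= j)%N -> (s i <= s j)%N.
Proof.
have := @homo_leq _ s leq leqnn leq_trans.
by apply=> k; exact: ltnW.
Qed.

Let s_ge k : (k <= s k)%N.
Proof. by elim: k => // k IHk; exact: leq_ltn_trans IHk (s_lt k). Qed.

Let sum01 (h : nat -> R) i j : (forall i, 0 <= h i <= 1) -> (i <= j)%N ->
  0 <= \sum_(i <= t < j) h t <= (j - i)%:R.
Proof.
move=> h01 ij; rewrite sumr_ge0/=; last by move=> t _; case/andP: (h01 t).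
rewrite -[(j - i)%N]muln1 -sum_nat_const_nat natr_sum.
by apply: ler_sum => t _; case/andP: (h01 t).
Qed.

(** Between s_0 and s_k the finite sequence agrees with [b]. The terms outside this range lie in
    [0, 1] and are bounded by their number. *)
Let sum_bn_bounds k n : (s k + m <= n < s k.+1 + m)%N ->
  \sum_(s 0 <= i < s k) b i <= \sum_(i < n) bn n i <=
  \sum_(s 0 <= i < s k) b i + (s 0)%:R + (s k.+1 + m - s k)%:R.
Proof.
move=> /andP[skn nsk].
have sn : (s k <= n)%N by exact: leq_trans (leq_addr _ _) skn.
have ss : (s 0 <= s k)%N by exact: s_le.
(* Extends [bn n] to all natural indices, with value 0 beyond n, so that the sum can be cut at s_0
   and s_k. *)
pose h i := if (i < s k)%N then b i else if insub i is Some j then bn n j else 0.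
have h01 i : 0 <= h i <= 1.
  rewrite /h; case: ifP => // _; case: insub => [j|]; first exact: bn01.
  by rewrite lexx ler01.
have -> : \sum_(i < n) bn n i = \sum_(0 <= i < n) h i.
  rewrite big_mkord; apply: eq_bigr => i _; rewrite /h.
  by case: ifP => [isk|_]; [exact: bnE skn i isk|rewrite valK].
rewrite (big_cat_nat (leq0n (s k)) sn) (big_cat_nat (leq0n (s 0)) ss)/=.
have -> : \sum_(s 0 <= i < s k) h i = \sum_(s 0 <= i < s k) b i.
  by apply: eq_big_nat => i /andP[_ isk]; rewrite /h isk.
have /andP[h1 h2] := sum01 h01 (leq0n (s 0)).
have /andP[h3 h4] := sum01 h01 sn.
have h5 : (n - s k)%:R <= (s k.+1 + m - s k)%:R :> R by rewrite ler_nat; lia.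
move: h2; rewrite subn0 => h2.
by apply/andP; split; lra.
Qed.

Variables (nu tau : R).
Hypotheses
  (s_tau : (\sum_(s 0 <= i < s k) 1) / k%:R @[k --> \oo] --> tau)
  (b_nu : (\sum_(s 0 <= i < s k) b i) / k%:R @[k --> \oo] --> nu).

Let cvg_div_nat (x : R) : x / k%:R @[k --> \oo] --> (0 : R).
Proof.
rewrite -[X in _ --> X](mulr0 x).
apply: cvgM; first exact: cvg_cst.
by rewrite -cvg_shiftS; exact: cvg_harmonic.
Qed.

Let s_div k : (s k)%:R / k%:R =
  (\sum_(s 0 <= i < s k) 1) / k%:R + (s 0)%:R / k%:R :> R.
Proof.
rewrite -mulrDl; congr (_ / _).
by rewrite sumr_const_nat -natrD subnK// s_le.
Qed.

Let s_div_tau : (s k)%:R / k%:R @[k --> \oo] --> tau.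
Proof.
rewrite (_ : (fun _ => _) = fun k => (\sum_(s 0 <= i < s k) 1) / k%:R + (s 0)%:R / k%:R).
  by rewrite -[X in _ --> X]addr0; apply: cvgD s_tau _; exact: cvg_div_nat.
by apply/funext => k; exact: s_div.
Qed.

(** Each cycle has length at least 1, so s_k >= k; this makes division by [tau] legitimate. *)
Let tau_ge1 : 1 <= tau.
Proof.
apply: (cvgr_to_ge s_div_tau); near=> k.
rewrite ler_pdivlMr ?mul1r ?ler_nat//.
by rewrite ltr0n; near: k; exact: nbhs_infty_gt.
Unshelve. all: by end_near. Qed.

Let sS_div_tau : (s k.+1)%:R / k%:R @[k --> \oo] --> tau.
Proof.
have h : (s k.+1)%:R / k.+1%:R @[k --> \oo] --> tau.
  by have := s_div_tau; rewrite -(cvg_shiftS (fun k => (s k)%:R / k%:R : R)).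
have h1 : 1 + 1 / k%:R @[k --> \oo] --> (1 + 0 : R).
  by apply: cvgD; [exact: cvg_cst|exact: cvg_div_nat].
have := cvgM h h1; rewrite addr0 mulr1 => /(_ _); apply: cvg_trans.
apply: near_eq_cvg; near=> k.
have k0 : k%:R != 0 :> R.
  by rewrite pnatr_eq0 -lt0n; near: k; exact: nbhs_infty_gt.
have k1 : k.+1%:R != 0 :> R by rewrite pnatr_eq0.
by rewrite /= -natr1 in k1 *; field; rewrite k0.
Unshelve. all: by end_near. Qed.

Lemma renewal_average_cvg :
  n%:R^-1 * \sum_(i < n) bn n i @[n --> \oo] --> nu / tau.
Proof.
have tau0 : 0 < tau by exact: lt_le_trans ltr01 tau_ge1.
(* J n is the last k with s_k + m <= n; below s_0 + m no such k exists and 0 serves as default. *)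
have : forall n, exists k, (s 0 + m <= n)%N -> (s k + m <= n < s k.+1 + m)%N.
  move=> n; have [sn|] := leqP (s 0 + m) n; last by exists 0%N.
  have ex : exists k, (n < s k + m)%N.
    by exists n.+1; have := s_ge n.+1; lia.
  have [k kP kmin] := ex_minnP ex.
  case: k kP kmin => [|k] kP kmin; first lia.
  exists k => _; rewrite kP andbT leqNgt; apply/negP => /kmin.
  by rewrite ltnn.
move=> /choice[J JP].
have J_oo : J n @[n --> \oo] --> \oo.
  apply/cvgnyPge => K; near=> n.
  have snK : (s 0 + m + s K + m <= n)%N by near: n; exact: nbhs_infty_ge.
  have /andP[_ h] : (s (J n) + m <= n < s (J n).+1 + m)%N by apply: JP; lia.
  rewrite leqNgt; apply/negP => JK.
  by have := s_le JK; lia.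
pose C k := \sum_(s 0 <= i < s k) b i.
(* The bounds for the sum up to n, divided by the upper bound s_(k+1) + m and the lower bound s_k
   for n. *)
pose lo k : R := C k / (s k.+1 + m)%:R.
pose hi k : R := (C k + (s 0)%:R + (s k.+1 + m - s k)%:R) / (s k)%:R.
have sm_cvg : (s k.+1)%:R / k%:R + m%:R / k%:R @[k --> \oo] --> tau.
  by rewrite -[X in _ --> X]addr0; apply: cvgD sS_div_tau _; exact: cvg_div_nat.
have lo_cvg : lo k @[k --> \oo] --> nu / tau.
  have := cvgM b_nu (cvgV (lt0r_neq0 tau0) sm_cvg).
  move=> /(_ _ _); apply: cvg_trans; apply: near_eq_cvg; near=> k.
  have k0 : k%:R != 0 :> R.
    by rewrite pnatr_eq0 -lt0n; near: k; exact: nbhs_infty_gt.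
  by rewrite /unstable.inv_fun /= /lo /C natrD -mulrDl invfM invrK mulrACA mulVf// mulr1.
(* The last incomplete cycle is negligible: s_(k+1)/k and s_k/k have the same limit, so their
   difference tends to 0. *)
have hi_cvg : hi k @[k --> \oo] --> nu / tau.
  have := cvgM (cvgD (cvgD b_nu (cvg_div_nat (s 0)%:R)) (cvgB sm_cvg s_div_tau))
    (cvgV (lt0r_neq0 tau0) s_div_tau).
  rewrite subrr !addr0 => /(_ _ _ _ _ _); apply: cvg_trans; apply: near_eq_cvg; near=> k.
  have k0 : k%:R != 0 :> R.
    by rewrite pnatr_eq0 -lt0n; near: k; exact: nbhs_infty_gt.
  rewrite [LHS](_ : _ = (C k / k%:R + (s 0)%:R / k%:R +
    ((s k.+1)%:R / k%:R + m%:R / k%:R - (s k)%:R / k%:R)) /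
    ((s k)%:R / k%:R))//.
  rewrite /hi natrB; last by have := s_lt k; lia.
  by rewrite natrD -!mulrDl -mulrBl -mulrDl invfM invrK mulrACA mulVf// mulr1.
have J_pos : \forall n \near \oo, (0 < J n)%N.
  by move/cvgnyPgt : J_oo; apply.
apply: (@squeeze_cvgr _ _ _ _ (fun n => lo (J n)) (fun n => hi (J n))).
- near=> n.
  have n0 : (0 < n)%N by near: n; exact: nbhs_infty_gt.
  have sn : (s 0 + m <= n)%N by near: n; exact: nbhs_infty_ge.
  have J0 : (0 < J n)%N by near: n; exact: J_pos.
  have sJ0 : (0 < s (J n))%N by exact: leq_trans J0 (s_ge _).
  have Jn := JP n sn; have /andP[c1 c2] := sum_bn_bounds Jn.
  have /andP[c3 _] := sum01 b01 (s_le (leq0n (J n))).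
  have /andP[n1 n2] := Jn.
  rewrite mulrC /lo /hi /C; apply/andP; split.
    apply: ler_pM => //.
    by rewrite lef_pV2 ?posrE ?ltr0n ?ler_nat; lia.
  apply: ler_pM => //; first exact: le_trans c3 c1.
  by rewrite lef_pV2 ?posrE ?ltr0n ?ler_nat; lia.
- exact: cvg_comp J_oo lo_cvg.
- exact: cvg_comp J_oo hi_cvg.
Unshelve. all: by end_near. Qed.

End renewal_average.

(** * Empirical risk *)

Section empirical_risk.
Context {d d'} {Om : measurableType d} {T : measurableType d'} {R : realType}.
Variables (P : probability Om R) (N : nat).
Variables (Y : nat -> {RV P >-> 'I_N.+1}) (X : nat -> {RV P >-> T}).
Variable v : forall n, {mfun (n.-tuple T) >-> (n.-tuple 'I_N.+1)}.
Variable l : 'I_N.+1 -> 'I_N.+1 -> R.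
Hypothesis l_ge0 : forall a b, 0 <= l a b.

Let V n (i : 'I_n) w := tnth (v n (first_n X n w)) i.

(** Isolates the hidden state in an indicator; the remaining factor [l a (V i w)] is a function of
    X^n and can leave the conditional expectation. *)
Lemma empirical_riskE n : empirical_risk Y X v l n = fun w =>
  n%:R^-1 * \sum_(i < n) \sum_a l a (V i w) * \1_(Y i @^-1` [set a]) w.
Proof.
apply/funext => w; congr (_ * _); apply: eq_bigr => i _.
rewrite (bigD1 (Y i w))//= indicE mem_set// mulr1 big1 ?addr0// => a aY.
by rewrite indicE memNset ?mulr0//= => Ya; move: aY; rewrite Ya eqxx.
Qed.

Lemma empirical_risk_freqE n w : empirical_risk Y X v l n w =
  \sum_a \sum_b l a b *
    (n%:R^-1 * \sum_(i < n) ((Y i w == a) && (V i w == b))%:R).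
Proof.
under eq_bigr => a _.
  under eq_bigr => b _.
    rewrite mulrCA mulr_sumr.
    over.
  rewrite -mulr_sumr exchange_big/=.
  over.
rewrite -mulr_sumr exchange_big/=; congr (_ * _); apply: eq_bigr => i _.
rewrite (bigD1 (Y i w))//= (bigD1 (V i w))//= !eqxx mulr1.
rewrite !big1 ?addr0// => [a aY|b bV].
  by apply: big1 => b _; rewrite eq_sym (negbTE aY) mulr0.
by rewrite [_ == b]eq_sym (negbTE bV) mulr0.
Qed.

Lemma measurable_decoded n (i : 'I_n) : measurable_fun setT (V i).
Proof.
apply: (measurableT_comp (measurable_tnth i)).
by apply: measurableT_comp => //; exact: measurable_first_n.
Qed.

Lemma measurable_empirical_risk n :
  measurable_fun setT (empirical_risk Y X v l n).
Proof.
rewrite empirical_riskE.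
apply: measurable_funM => //; apply: measurable_sum => i.
apply: measurable_sum => a; apply: measurable_funM.
  by apply: (measurableT_comp (f := l a)) => //; exact: measurable_decoded.
by apply: measurable_indic; rewrite -[X in measurable X]setTI; exact: measurable_funP.
Qed.

Lemma empirical_risk_ge0 n w : 0 <= empirical_risk Y X v l n w.
Proof. by rewrite mulr_ge0 ?invr_ge0// sumr_ge0. Qed.

Lemma empirical_risk_le n w : `|empirical_risk Y X v l n w| <= \sum_a \sum_b l a b.
Proof.
set L := \sum_a _; have L0 : 0 <= L by do 2 apply: sumr_ge0 => ? _.
rewrite ger0_norm ?empirical_risk_ge0//.
have lL a b : l a b <= L.
  rewrite /L (bigD1 a)//= (bigD1 b)//= -addrA lerDl addr_ge0//.
    exact: sumr_ge0.
  by apply: sumr_ge0 => ? _; exact: sumr_ge0.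
apply: (@le_trans _ _ (n%:R^-1 * \sum_(i < n) L)).
  by apply: ler_wpM2l; rewrite ?invr_ge0//; apply: ler_sum => i _; exact: lL.
rewrite sumr_const card_ord -[L *+ n]mulr_natr mulrCA.
(* For n = 0 the inverse is 0 by convention and the average vanishes. *)
case: n => [|n]; first by rewrite invr0 mul0r mulr0.
by rewrite mulVf ?mulr1// pnatr_eq0.
Qed.

Lemma cond_exp_empirical_risk n (rho : 'I_n -> 'I_N.+1 -> Om -> R) :
  (forall (t : 'I_n) (a : 'I_N.+1),
     is_cond_exp P (sigma_first_n X n) (\1_(Y t @^-1` [set a])) (rho t a)) ->
  is_cond_exp P (sigma_first_n X n) (empirical_risk Y X v l n)
    (fun w => n%:R^-1 * \sum_(t < n) \sum_a l a (V t w) * rho t a w).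
Proof.
move=> rhoP.
have Fs := sigma_first_n_sigma_algebra X n.
have Fm : sigma_first_n X n `<=` measurable.
  exact: sigma_first_n_measurable.
have mY (t : 'I_n) a : measurable (Y t @^-1` [set a]).
  by rewrite -[X in measurable X]setTI; exact: measurable_funP.
have i1 (t : 'I_n) a : P.-integrable setT (EFin \o \1_(Y t @^-1` [set a])).
  exact: integrable_indic.
rewrite empirical_riskE.
have il (t : 'I_n) a : P.-integrable setT
    (EFin \o (fun w => l a (V t w) * \1_(Y t @^-1` [set a]) w)).
  apply: (@bounded_prob_integrable _ _ _ _ (\sum_b l a b)).
    apply: measurable_funM; last exact: measurable_indic.
    by apply: (measurableT_comp (f := l a)) => //; exact: measurable_decoded.
  move=> w; rewrite ger0_norm ?mulr_ge0// -[leRHS]mulr1 ler_pM//.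
  by rewrite (bigD1 (V t w))//= lerDl sumr_ge0.
have isum (t : 'I_n) : P.-integrable setT
    (EFin \o (fun w => \sum_a l a (V t w) * \1_(Y t @^-1` [set a]) w)).
  rewrite (_ : _ \o _ = (fun w =>
      \sum_a (l a (V t w) * \1_(Y t @^-1` [set a]) w)%:E)%E); last first.
    by apply/funext => w /=; rewrite -sumEFin.
  by apply: integrable_sum => // a _; exact: il.
apply: (cond_expZ Fs Fm).
  rewrite (_ : _ \o _ = (fun w => \sum_(t < n)
      (\sum_a l a (V t w) * \1_(Y t @^-1` [set a]) w)%:E)%E); last first.
    by apply/funext => w /=; rewrite -sumEFin.
  by apply: integrable_sum => // t _; exact: isum.
apply: (cond_exp_sum Fs Fm) => // t; apply: (cond_exp_sum Fs Fm) => // a.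
apply: (cond_exp_finM Fs Fm) => // b.
rewrite (_ : _ @^-1` _ =
  (((fun s => tnth s t) \o v n) \o first_n X n) @^-1` [set b])//.
apply: sigma_first_n_preimage => //.
by apply: measurableT_comp => //; exact: measurable_tnth.
Qed.

(** The limit is the mean number of visits of (Y, V) to (a, b) in a cycle divided by the mean cycle
    length. *)
Lemma consistent_frequency_cvg (Xo : set T) (r : nat) (a b : 'I_N.+1) :
  consistent Y X v Xo r ->
  exists2 pi : R, 0 <= pi & {ae P, forall w,
    n%:R^-1 * \sum_(i < n) ((Y i w == a) && (V i w == b))%:R
      @[n --> \oo] --> pi}.
Proof.
move=> [vinf [_ [S [m [[reg rec _] _ hS _]]]]].
pose Z t w := (X t w, Y t w, vinf (X ^~ w) t).
pose B : set (T * 'I_N.+1 * 'I_N.+1) := (setT `*` [set a]) `*` [set b].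
have mB : measurable B by apply: measurableX => //; exact: measurableX.
(* Visits to the whole space count time, so this instance gives the mean cycle length [tau]. *)
have slln1 := visits_slln reg rec measurableT.
have sllnB := visits_slln reg rec mB.
set nu := fine _ in sllnB; set tau := fine _ in slln1.
have visits_ge0 A : 0 <= fine (\int[P]_w (cycle_visits Z S A w)%:E).
  by apply/fine_ge0/integral_ge0 => w _; rewrite lee_fin cycle_visits_ge0.
exists (nu / tau); first exact: divr_ge0 (visits_ge0 B) (visits_ge0 setT).
apply: filterS3 (filterI slln1 sllnB) hS (reg_increasing reg) => w [c1 cB] hw S_lt.
have ZB t : \1_B (Z t w) = ((Y t w == a) && (vinf (X ^~ w) t == b))%:R :> R.
  rewrite indicE; congr (nat_of_bool _)%:R; apply/idP/idP.
    by move=> /set_mem[[_ /= ->] ->]; rewrite !eqxx.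
  by move=> /andP[/eqP Ya /eqP Vb]; apply/mem_set.
have bool01 (x : bool) : 0 <= (x%:R : R) <= 1.
  by case: x; rewrite ?lexx ?ler01.
apply: (@renewal_average_cvg _ (fun k => S k w) m (fun t => \1_B (Z t w))
  (fun n i => ((Y i w == a) && (V i w == b))%:R)) => //.
- by move=> t; rewrite ZB.
- move=> j n Sn i iS; rewrite ZB; case: hw => _ hV _.
  by rewrite /V (hV j n Sn i iS).
- by move: c1; rewrite indicT.
Qed.

End empirical_risk.

(** * Limits of the empirical and the conditional risks *)

Theorem theorem3p1
    (R : realType) (d d' : measure_display)
    (Om : measurableType d) (T : measurableType d') (P : probability Om R)
    (N : nat) (Y : nat -> {RV P >-> 'I_N.+1}) (X : nat -> {RV P >-> T})
    (p : 'M[R]_N.+1) (mu : {measure set T -> \bar R}) (f : 'I_N.+1 -> T -> R)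
    (Pe : 'I_N.+1 -> probability T R)
    (hmm : ergodic_hmm Y X p mu f Pe)
    (C : {set 'I_N.+1}) (r : nat)
    (A1_cluster : is_cluster f Pe C)
    (A1_primitive : primitive_with_exponent p C r)
    (A2 : assumption_A2 p f Pe)
    (Xo : set T) (hXo : good_emission_set mu f C Xo)
    (q : forall n, n.-tuple 'I_N.+1 -> n.-tuple T -> R)
    (hq : forall n, (0 < n)%N -> is_posterior Y X (@q n))
    (v : forall n, {mfun (n.-tuple T) >-> (n.-tuple 'I_N.+1)})
    (hv : forall n, (0 < n)%N -> is_viterbi (@q n) (v n))
    (hcons : consistent Y X v Xo r)
    (l : 'I_N.+1 -> 'I_N.+1 -> R) (l_ge0 : forall a b, 0 <= l a b)
    (Rv : nat -> Om -> R)
    (hRv : forall n, (0 < n)%N ->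
       is_cond_exp P (sigma_first_n X n) (empirical_risk Y X v l n) (Rv n)) :
  (forall (n : nat) (rho : 'I_n -> 'I_N.+1 -> Om -> R), (0 < n)%N ->
     (forall (t : 'I_n) (a : 'I_N.+1),
        is_cond_exp P (sigma_first_n X n)
          (\1_(Y t @^-1` [set a])) (rho t a)) ->
     {ae P, forall w, Rv n w =
        n%:R^-1 * \sum_(t < n) \sum_(a < N.+1)
          l a (tnth (v n (first_n X n w)) t) * rho t a w}) /\
  exists R1 : R,
    [/\ 0 <= R1,
        cvg_as_L1 P (empirical_risk Y X v l) R1,
        cvg_as_L1 P Rv R1
      & ('E_P[Rv n] @[n --> \oo] --> R1%:E)%E].
Proof.
have Fs := sigma_first_n_sigma_algebra X.
have Fm n : sigma_first_n X n `<=` measurable by exact: sigma_first_n_measurable.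
split=> [n rho n0 rhoP|].
  (* The explicit posterior average is another version of the conditional expectation of which
     [Rv n] is a version. *)
  exact: (cond_exp_ae_unique (Fs n) (@Fm n) (hRv n n0)
    (cond_exp_empirical_risk v l_ge0 rhoP)).
have freq a b := consistent_frequency_cvg a b hcons.
pose pi a b := sval (cid2 (freq a b)).
have pi_ge0 a b : 0 <= pi a b by rewrite /pi; case: cid2.
(* The loss averaged over the limiting joint frequencies of hidden and decoded states. *)
exists (\sum_a \sum_b l a b * pi a b).
have risk_cvg : {ae P, forall w,
    empirical_risk Y X v l n w @[n --> \oo] --> \sum_a \sum_b l a b * pi a b}.
  have freq_cvg : {ae P, forall w, forall a b,
      n%:R^-1 * \sum_(i < n)
        ((Y i w == a) && (tnth (v n (first_n X n w)) i == b))%:R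
      @[n --> \oo] --> pi a b}.
    (* There are finitely many pairs (a, b), so one null set serves for all of them. *)
    apply: filter_forall => a; apply: filter_forall => b.
    by rewrite /pi; case: cid2.
  apply: filterS freq_cvg => w fw.
  under eq_fun do rewrite empirical_risk_freqE.
  apply: cvg_big => [|a _]; first exact: add_continuous.
  apply: cvg_big => [|b _]; first exact: add_continuous.
  by apply: cvgM; [exact: cvg_cst|exact: fw].
have [risk_L1 Rv_L1 E_Rv] := cond_exp_cvg_as_L1 Fs Fm
  (fun m n mn => sigma_first_n_mono mn) (measurable_empirical_risk Y X v l)
  (empirical_risk_le Y X v l_ge0) hRv risk_cvg.
split => //.
by do 2 (apply: sumr_ge0 => ? _); rewrite mulr_ge0.
Qed.
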